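(* For $\alpha\in\mathcal C$, let $$B_\alpha(t)=\prod_{i\in\mathbb Z}\binom{t+i}{\alpha_i}.$$ This is a polynomial in $t$, and $B_\alpha(t)=\mathbf e_{\gamma^t(\alpha)}(1)$ for every integer $t\ge d(\alpha)$. Moreover, for every $w\in S_{\mathbb Z}$, $$\mathfrak T_w(t)=\sum_{\alpha\in\mathcal C}\overleftarrow{\kappa^w_\alpha}\cdot B_\alpha(t)$$ as polynomials in $t$.
   Context: Indices. $\mathcal C$ is the set of finitely supported tuples $\alpha=(\alpha_i)_{i\in\mathbb Z}$ of nonnegative integers, with shift $\gamma(\alpha)_i=\alpha_{i-1}$, and $d(\alpha)=\max_{i:\alpha_i\ne 0}(\alpha_i-i)$, with $d(0)=0$. Here $\binom{t+i}{k}=(t+i)(t+i-1)\cdots(t+i-k+1)/k!$. Ordinary SEMs. If $a\in\mathcal C$ is supported on positive integers and $a_i\le i$ for all $i\ge1$, then $\mathbf e_a=\prod_{i\ge1}\mathbf e_{a_i}(x_1,\ldots,x_i)$; $f(1)$ denotes the value of a polynomial $f\in\mathbb Q[x_1,x_2,\ldots]$ with all variables set to $1$. (For $t\ge d(\alpha)$ the index $\gamma^t(\alpha)$ satisfies this condition.) Permutations. $S_{\mathbb Z}$ is the group of permutations of $\mathbb Z$ moving only finitely many integers; $S_\infty\subset S_{\mathbb Z}$ is the subgroup of those fixing every $i\le 0$; $s_i=(i,i+1)$; $\ell$ is Coxeter length. The shift acts by $\gamma(w)(i)=w(i-1)+1$ and $\gamma(x_i)=x_{i+1}$. $R(w)$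 is the set of reduced words of $w$: sequences $a=(a_1,\ldots,a_{\ell(w)})$ of integers with $w=s_{a_1}\cdots s_{a_{\ell(w)}}$. Shifted specialization polynomial. For $w\in S_{\mathbb Z}$, $\mathfrak T_w(t)=\frac1{\ell(w)!}\sum_{a\in R(w)}(t+a_1)(t+a_2)\cdots(t+a_{\ell(w)})$. Back stable coefficients. $\Lambda^-=\Lambda(\ldots,x_{-1},x_0)$ is the ring of symmetric functions over $\mathbb Q$ in the variables $x_i$, $i\le0$, and $\mathcal R=\Lambda^-\otimes_{\mathbb Q}\mathbb Q[x_i\mid i\in\mathbb Z]$, identified via multiplication with a ring of bounded-degree formal power series. The elements $\overleftarrow{\mathbf e}_\alpha=\prod_{i\in\mathbb Z}\mathbf e_{\alpha_i}(\ldots,x_{i-1},x_i)$ ($\alpha\in\mathcal C$), where $\mathbf e_d(\ldots,x_{k-1},x_k)$ is the elementary symmetric function in $x_i$, $i\le k$, form a $\mathbb Q$-basis of $\mathcal R$. For $u\in S_\infty$, $\mathfrak S_u$ is the usual Schubert polynomial: $\mathfrak S_{w_0}=x_1^{n-1}\cdots x_{n-1}$ for the longest $w_0\in S_n$, and $\partial_i\mathfrak S_u=\mathfrak S_{us_i}$ whenever $\ell(us_i)<\ell(u)$, where $\partial_i f=(f-s_if)/(x_i-x_{i+1})$. For $w\in S_{\mathbb Z}$, $\overleftarrow{\mathfrak S}_w=\lim_{m\to\infty}\gamma^{-m}\big(\mathfrak S_{\gamma^m(w)}\big)\in\mathcal R$ (coefficientwise limit, over $m$ with $\gamma^m(w)\in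 S_\infty$), and $\overleftarrow{\kappa^w_\alpha}$ is defined by $\overleftarrow{\mathfrak S}_w=\sum_{\alpha\in\mathcal C}\overleftarrow{\kappa^w_\alpha}\,\overleftarrow{\mathbf e}_\alpha$. *)

(* Defs.v *)
From mathcomp Require Import all_boot all_order all_algebra.
From mathcomp Require Import finmap monalg.
From mathcomp Require Import boolp classical_sets cardinality fsbigop.

Set Implicit Arguments.
Unset Strict Implicit.
Unset Printing Implicit Defensive.

Import Order.TTheory GRing.Theory Num.Theory.

Local Open Scope classical_set_scope.
Local Open Scope fset_scope.
Local Open Scope ring_scope.

(** * Indices *)

Definition sem_index := {fsfun int -> nat with 0%N}.

Implicit Types (alpha : sem_index) (w u : int -> int) (i j t : int).

(* gamma^t, for t of either sign *)
Definition shift_index t alpha : sem_index :=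
  [fsfun i in [fset j + t | j in finsupp alpha] => alpha (i - t)].

(* The starting value of the maximum is itself one of the competing values
   when alpha != 0, and is alpha 0 - 0 = 0 when alpha = 0; so d(alpha) can be
   negative. *)
Definition index_deg alpha : int :=
  let i0 := head 0 (finsupp alpha) in
  \big[Num.max/(alpha i0)%:Z - i0]_(i <- finsupp alpha) ((alpha i)%:Z - i).

Definition binom (x : rat) (k : nat) : rat :=
  (\prod_(j < k) (x - j%:R)) / (k`!)%:R.

Definition B alpha (x : rat) : rat :=
  \prod_(i <- finsupp alpha) binom (x + i%:~R) (alpha i).

(** * Polynomials in the variables x_i, i an integer *)

Definition monom := {cmonom int}.
Definition zpoly := {malg rat[{cmonom int}]}.

Definition X i : zpoly := << ucm i >>.

(* the Q-algebra endomorphism x_j |-> x_(p j) *)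
Definition rename (p : int -> int) (f : zpoly) : zpoly :=
  mmap (fun c : rat => c%:MP)
       (fun m : monom => \prod_(j <- finsupp m) X (p j) ^+ m j) f.

(* f(1) *)
Definition at_one (f : zpoly) : rat := mmap idfun (fun _ : monom => 1) f.

(* e_d(x_1, ..., x_k) *)
Definition elem_sym (k d : nat) : zpoly :=
  \sum_(h : {set 'I_k} | #|h| == d) \prod_(j in h) X (j.+1)%:Z.

(* Meant for alpha supported on positive integers with alpha i <= i; elsewhere
   it is 0, being a product with some factor e_d, d > 0, in fewer than d
   variables. *)
Definition sem alpha : zpoly :=
  \prod_(i <- finsupp alpha) elem_sym (if i is Posz k then k else 0%N) (alpha i).

(** * Permutations *)

Definition in_SZ w : Prop := bijective w /\ finite_set [set i | w i <> i].

Definition in_Sinf w : Prop := in_SZ w /\ forall i, i <= 0 -> w i = i.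

Definition s_ i : int -> int :=
  fun j => if j == i then i + 1 else if j == i + 1 then i else j.

Definition shift_perm t w : int -> int := fun i => w (i - t) + t.

(* s_(a_1) o ... o s_(a_l) *)
Definition word_perm (a : seq int) : int -> int :=
  foldr (fun i u => s_ i \o u) id a.

Definition coxlen w : nat :=
  xget 0%N [set n | (exists2 a, size a = n & word_perm a = w) /\
                    (forall b, word_perm b = w -> (n <= size b)%N)].

Definition reduced_words w : set (seq int) :=
  [set a | size a = coxlen w /\ word_perm a = w].

Definition T_ w : {poly rat} :=
  ((coxlen w)`!%:R)^-1 *:
    \sum_(a \in reduced_words w) \prod_(i <- a) ('X + (i%:~R)%:P : {poly rat}).

(** * Schubert polynomials *)

(* the longest element of S_n *)
Definition w0 (n : nat) : int -> int :=
  fun i => if (1 <= i) && (i <= n%:Z) then n%:Z + 1 - i else i.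

(* [is_divdiff i f g] : g = (f - s_i f) / (x_i - x_(i+1)) *)
Definition is_divdiff i (f g : zpoly) : Prop :=
  (X i - X (i + 1)) * g = f - rename (s_ i) f.

Definition is_schubert_family (S : (int -> int) -> zpoly) : Prop :=
  (forall n : nat, S (w0 n) = \prod_(i < n) X (i.+1)%:Z ^+ (n - i.+1)) /\
  (forall u i, in_Sinf u -> (coxlen (u \o s_ i) < coxlen u)%N ->
     is_divdiff i (S u) (S (u \o s_ i))).

(* The family is determined by these conditions on S_infinity, and its values
   elsewhere are not used. *)
Definition schubert : (int -> int) -> zpoly :=
  xget (fun=> 0) [set S | is_schubert_family S].

(** * Back stable Schubert functions, as formal power series *)

Definition series := monom -> rat.

Definition series1 : series := fun m => (m == mone)%:R.

Definition series_mul (f g : series) : series := fun m =>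
  \sum_(p \in [set p : monom * monom | mmul p.1 p.2 = m]) f p.1 * g p.2.

(* e_d(..., x_(k-1), x_k): the sum of the squarefree monomials of degree d in
   the variables x_i, i <= k *)
Definition back_esym (k : int) (d : nat) : series := fun m =>
  ((mdeg m == d) && all (fun i => (i <= k) && (m i == 1%N)) (finsupp m))%:R.

Definition back_sem alpha : series :=
  \big[series_mul/series1]_(i <- finsupp alpha) back_esym i (alpha i).

(* The coefficientwise limit is in the sense of formal power series: each
   coefficient is eventually constant. *)
Definition back_schubert w : series := fun m =>
  xget 0 [set c : rat | exists N : nat, forall n : nat, (N <= n)%N ->
    in_Sinf (shift_perm n%:Z w) ->
    (rename (fun j => j - n%:Z) (schubert (shift_perm n%:Z w)))@_m = c].

(* the coordinates of the back stable Schubert function of w in the basis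
   [back_sem] *)
Definition kappa w : {fsfun sem_index -> rat with 0} :=
  xget [fsfun] [set c : {fsfun sem_index -> rat with 0} |
    forall m : monom,
      back_schubert w m = \sum_(a <- finsupp c) c a * back_sem a m].

(* Main.v *)
Require Import Defs.
From HB Require Import structures.
From mathcomp Require Import all_boot all_order all_algebra.
From mathcomp Require Import finmap monalg.
From mathcomp Require Import boolp classical_sets cardinality fsbigop.
From mathcomp Require Import zify ring.

(** The Schubert polynomials of [S_infinity] are the coefficients of the
    Fomin-Stanley product in the nilCoxeter algebra; commutation of its rows
    gives the divided difference relations, so [schubert] is this family.
    - Specialization: [(partial_k f)(1) = (D_k f - D_(k+1) f)(1)], where
      [partial_k] is the divided difference and [D_k] the derivative in [x_k].
      Hence, for [f] homogeneous of degree [l], Abel summation and Euler's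
      identity give [l f(1) = sum_k k (partial_k f)(1)], which is the recursion
      on last letters of reduced words, and Macdonald's identity follows:
      [T_w(t)] is the value at 1 of the Schubert polynomial of [gamma^t w] for
      large [t].
    - Expansion: [schubert (gamma^t w)] is symmetric in its first [K > l(w)]
      variables, so it is a polynomial in the [e_d(x_1..x_k)] with [k >= K];
      these straighten to standard monomials with pairwise distinct [k].  The
      coefficients do not depend on [t]: the difference of the two sides
      for [t + 1] vanishes at [x_1 = 0], so by symmetry it is divisible by
      [x_1 ... x_K], which exceeds its degree.
    Evaluating any such expansion at 1 gives an equality of polynomials at all
    large integers. *)

Set Implicit Arguments.
Unset Strict Implicit.
Unset Printing Implicit Defensive.

Import Order.TTheory GRing.Theory Num.Theory.

Local Open Scope ring_scope.

Implicit Types (w u : int -> int) (i j k t : int).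

(** * Inversions and Coxeter length *)

(** Two definitions by choice shape the proof. [schubert] is whichever family satisfies its axioms,
    so a family has to be exhibited and shown to be the only one on S_infinity. The nilCoxeter
    product gives the values at all permutations at once, so the consistency of divided differences
    along different chains down from w_0 is built in; uniqueness is a downward induction on length
    from w_0. Likewise [kappa w] is whichever expansion the choice returns, and it lives among power
    series, where nothing can be evaluated at 1. The bridge is truncation: dropping the variables
    x_i with i <= -T and shifting by T respects sums and products, and turns e_d(..., x_k) into
    e_d(x_1, ..., x_(k+T)). Every expansion of the back stable function thus becomes an identity
    between polynomials. The bound K = l(w) + 1 is what the degree argument asks for; the symmetry
    in K variables is obtained by shifting [w] until it fixes 1, ..., K. *)

Lemma s_E k i : s_ k i = if i == k then k + 1 else if i == k + 1 then k else i.
Proof. by []. Qed.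

Lemma s_l k : s_ k k = k + 1. Proof. by rewrite s_E eqxx. Qed.
Lemma s_r k : s_ k (k + 1) = k. Proof. by rewrite s_E; case: eqP => [|_]; [lia|rewrite eqxx]. Qed.
Lemma s_out k i : i != k -> i != k + 1 -> s_ k i = i.
Proof. by rewrite s_E => /negbTE -> /negbTE ->. Qed.

Lemma s_K k : cancel (s_ k) (s_ k).
Proof. by move=> i; rewrite !s_E; do 4! (case: eqP => //; try lia). Qed.

Lemma comp_s_K w k : (w \o s_ k) \o s_ k = w.
Proof. by apply/funext => i /=; rewrite s_K. Qed.

Lemma s_bij k : bijective (s_ k). Proof. by exists (s_ k); exact: s_K. Qed.

Definition desc w k := w (k + 1) < w k.

Definition int_range (p : nat) : seq int := [seq n%:Z - p%:Z | n <- iota 0 (p + p).+1].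

Lemma mem_int_range p i : (i \in int_range p) = (`|i| <= p)%N.
Proof.
apply/mapP/idP => [[n]|ip]; first by rewrite mem_iota; lia.
exists `|(i + p%:Z)%R|%N; last lia.
by rewrite mem_iota; lia.
Qed.

Lemma uniq_int_range p : uniq (int_range p).
Proof. by rewrite map_inj_uniq ?iota_uniq // => a b; lia. Qed.

Definition bounded_perm (p : nat) w := bijective w /\ forall i, (p < `|i|)%N -> w i = i.

Lemma bounded_perm_le p q w : (p <= q)%N -> bounded_perm p w -> bounded_perm q w.
Proof. by move=> pq [bw fw]; split=> // i qi; apply: fw; exact: leq_ltn_trans qi. Qed.

Lemma in_SZP w : in_SZ w <-> exists p, bounded_perm p w.
Proof.
split=> [[bw fw]|[p [bw fw]]]; last first.
  split=> //; apply: (@sub_finite_set _ _ [set` int_range p]); last exact: finite_seq.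
  move=> i /= wi; suff: i \in int_range p by [].
  by rewrite mem_int_range leqNgt; apply/negP => /fw.
case/finite_fsetP: fw => F eF.
exists (\max_(i <- enum_fset F) `|i|%N); split=> // i hi.
apply: contrapT => wi.
have iF : i \in F by have : [set i | w i <> i]%classic i by []; rewrite eF.
move: hi; rewrite ltnNge => /negP; apply.
by rewrite (big_rem i) //= leq_maxl.
Qed.

Lemma bounded_perm_comp p w k : (`|k| <= p)%N -> (`|(k + 1)%R| <= p)%N -> bounded_perm p w ->
  bounded_perm p (w \o s_ k).
Proof.
move=> k1 k2 [bw fw]; split; first exact: bij_comp bw (s_bij k).
move=> i pi /=; rewrite s_out ?fw //; lia.
Qed.

Lemma in_SZ_comp w k : in_SZ w -> in_SZ (w \o s_ k).
Proof.
move/in_SZP => [p bp]; apply/in_SZP; exists (maxn p (`|k| + 1)%N).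
apply: bounded_perm_comp; [lia|lia|apply: bounded_perm_le bp; lia].
Qed.

Lemma in_SZ_inj w : in_SZ w -> injective w.
Proof. by case=> /bij_inj. Qed.

Lemma perm_int_range_s p k : (`|k| <= p)%N -> (`|(k + 1)%R| <= p)%N ->
  perm_eq [seq s_ k i | i <- int_range p] (int_range p).
Proof.
move=> k1 k2; apply: uniq_perm; rewrite ?uniq_int_range //.
  rewrite map_inj_uniq ?uniq_int_range //; exact: can_inj (s_K k).
move=> i; apply/mapP/idP => [[j]|ip].
  by rewrite !mem_int_range => jp ->; rewrite s_E; case: eqP => //; case: eqP => //; lia.
exists (s_ k i); last by rewrite s_K.
by move: ip; rewrite !mem_int_range s_E; case: eqP => //; case: eqP => //; lia.
Qed.

(** Counting inside a window keeps the sum finite. For a permutation fixing everything outside the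
    window the count is independent of the window, being the Coxeter length ([coxlen_inv]). *)
Definition inversions (p : nat) w : nat :=
  (\sum_(i <- int_range p) \sum_(j <- int_range p) ((i < j)%R && (w j < w i)%R))%N.

Lemma sum_delta (r : seq int) k (F : int -> nat) : uniq r -> k \in r ->
  (\sum_(i <- r) (i == k) * F i)%N = F k.
Proof.
move=> ur kr; rewrite (bigD1_seq k) //= eqxx mul1n big1 ?addn0 //.
by move=> i /negbTE ->.
Qed.

Lemma s_lt k i j : ~~ ((i == k) && (j == k + 1)) ->
  ~~ ((i == k + 1) && (j == k)) -> (s_ k i < s_ k j) = (i < j).
Proof.
rewrite !s_E; case: (i =P k) => ?; case: (j =P k) => ?;
  case: (i =P k + 1) => ?; case: (j =P k + 1) => ?; lia.
Qed.

(** Reindexing by [s_ k] keeps the order of all pairs of positions except (k, k + 1) and (k + 1, k),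
    so only these two terms differ. The descent sits on the left and the ascent on the right to
    avoid subtraction of naturals. *)
Lemma inversions_step p w k : (`|k| <= p)%N -> (`|(k + 1)%R| <= p)%N ->
  (inversions p (w \o s_ k) + desc w k = inversions p w + (w k < w (k + 1)%R)%R)%N.
Proof.
move=> k1 k2.
(* [D a b c] spreads the number [c] as a double sum concentrated at (a, b), so that the identity can
   be checked term by term. *)
pose D (a b : int) (c : nat) : nat := (\sum_(i <- int_range p) \sum_(j <- int_range p) (i == a) * ((j == b) * c))%N.
have DE a b c : (`|a| <= p)%N -> (`|b| <= p)%N -> D a b c = c.
  move=> ap bp; rewrite /D.
  under eq_bigr => i _ do rewrite -big_distrr /=.
  rewrite sum_delta ?uniq_int_range ?mem_int_range //.
  by rewrite sum_delta ?uniq_int_range ?mem_int_range.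
rewrite -[X in (_ + X)%N = _](DE k (k + 1)) // -[X in _ = (_ + X)%N](DE (k + 1) k) //.
have -> : inversions p (w \o s_ k) = (\sum_(i <- int_range p) \sum_(j <- int_range p) ((s_ k i < s_ k j)%R && (w j < w i)%R))%N.
  rewrite /inversions -(perm_big _ (perm_int_range_s k1 k2)) big_map /=.
  rewrite [RHS](eq_bigr (fun i => (\sum_(j <- int_range p) ((s_ k i < s_ k (s_ k j))%R && (w (s_ k j) < w i)%R))%N)).
    by apply: eq_bigr => i _; apply: eq_bigr => j _; rewrite !s_K.
  move=> i _; rewrite -[LHS](perm_big _ (perm_int_range_s k1 k2)) big_map /=.
  by [].
rewrite /inversions /D -!big_split /=; apply: eq_bigr => i _.
rewrite -!big_split /=; apply: eq_bigr => j _.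
have [/andP[/eqP-> /eqP->]|h1] := boolP ((i == k) && (j == k + 1)).
  rewrite s_l s_r !eqxx /desc.
  have -> : (k == k + 1) = false by lia.
  have -> : (k + 1 < k) = false by lia.
  have -> : (k < k + 1) by lia.
  by rewrite /= !mul1n mul0n addn0.
have [/andP[/eqP-> /eqP->]|h2] := boolP ((i == k + 1) && (j == k)).
  rewrite s_l s_r !eqxx /desc.
  have -> : (k + 1 == k) = false by lia.
  have -> : (k + 1 < k) = false by lia.
  have -> : (k < k + 1) by lia.
  by rewrite /= !mul1n mul0n addn0.
rewrite s_lt // !mulnA !mulnb (negbTE h1) (negbTE h2); lia.
Qed.

Lemma inversions_le p q w : (p <= q)%N -> (inversions p w <= inversions q w)%N.
Proof.
move=> pq.
have sub (F : int -> nat) : (\sum_(i <- int_range p) F i <= \sum_(i <- int_range q) F i)%N.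
  have P : perm_eq (int_range p ++ [seq i <- int_range q | i \notin int_range p]) (int_range q).
    apply: uniq_perm; rewrite ?uniq_int_range // ?cat_uniq ?uniq_int_range ?filter_uniq ?uniq_int_range ?andbT //.
      by apply/hasPn => i; rewrite mem_filter => /andP[].
    move=> i; rewrite mem_cat mem_filter !mem_int_range; lia.
  by rewrite -(perm_big _ P) big_cat /= leq_addr.
rewrite /inversions; apply: leq_trans (sub _).
by apply: leq_sum => i _; exact: sub.
Qed.

Lemma inversions_id p : inversions p id = 0%N.
Proof. by rewrite /inversions big1 // => i _; rewrite big1 // => j _; lia. Qed.

Lemma asc_lt w k : injective w -> ~~ desc w k -> w k < w (k + 1).
Proof.
rewrite /desc -leNgt le_eqVlt => wi /orP[/eqP/wi|//]; lia.
Qed.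

Lemma bounded_perm_range p w i : bounded_perm p w -> (`|i| <= p)%N -> (`|w i| <= p)%N.
Proof.
move=> [bw fw] ip; rewrite leqNgt; apply/negP => h.
by have := fw _ h => /(bij_inj bw) e; move: h; rewrite e ltnNge ip.
Qed.

(** Without descents [w] increases strictly on the window; starting from its two ends, this bounds
    each value below and above by its position. *)
Lemma no_desc_id p w : bounded_perm p w -> (forall k, - p%:Z <= k < p%:Z -> ~~ desc w k) ->
  w = id.
Proof.
move=> bp nd; have [bw fw] := bp; have wi := bij_inj bw.
have up (n : nat) : (n <= p + p)%N -> - p%:Z + n%:Z <= w (- p%:Z + n%:Z).
  elim: n => [|n IH] hn; first by have := @bounded_perm_range p w (- p%:Z + 0%N%:Z) bp _; lia.
  have := asc_lt wi (nd (- p%:Z + n%:Z) _).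
  have -> : - p%:Z + n%:Z + 1 = - p%:Z + n.+1%:Z by lia.
  have := IH; lia.
have dn (n : nat) : (n <= p + p)%N -> w (p%:Z - n%:Z) <= p%:Z - n%:Z.
  elim: n => [|n IH] hn; first by have := @bounded_perm_range p w (p%:Z - 0%N%:Z) bp _; lia.
  have := asc_lt wi (nd (p%:Z - n.+1%:Z) _).
  have -> : p%:Z - n.+1%:Z + 1 = p%:Z - n%:Z by lia.
  have := IH; lia.
apply/funext => i; have [ip|/fw//] := leqP `|i| p.
have := up `|(i + p%:Z)%R|%N; have := dn `|(p%:Z - i)%R|%N.
have -> : - p%:Z + `|(i + p%:Z)%R|%N%:Z = i by lia.
have -> : p%:Z - `|(p%:Z - i)%R|%N%:Z = i by lia.
lia.
Qed.

Lemma word_perm_rcons (a : seq int) k : word_perm (rcons a k) = word_perm a \o s_ k.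
Proof. by elim: a => //= i a ->. Qed.

Lemma inversions_desc p w k : bounded_perm p w -> - p%:Z <= k < p%:Z ->
  inversions p w = if desc w k then (inversions p (w \o s_ k)).+1 else (inversions p (w \o s_ k)).-1.
Proof.
move=> [bw _] hk; have := @inversions_step p w k; rewrite /desc.
have := @asc_lt w k (bij_inj bw); rewrite /desc.
by case: (ltP (w (k + 1)) (w k)) => /=; lia.
Qed.

(** Removing a descent on the right lowers the count by one, and a permutation without inversions
    has no descent, hence is the identity. *)
Lemma word_of_inv p w : bounded_perm p w -> exists2 a, size a = inversions p w & word_perm a = w.
Proof.
move en : (inversions p w) => n; elim: n w en => [|n IH] w en bp.
  exists [::] => //=; apply/esym/(no_desc_id bp) => k hk; apply/negP => partial1.
  by have := inversions_desc bp hk; rewrite partial1 en.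
have [k hk partial1] : exists2 k, - p%:Z <= k < p%:Z & desc w k.
  apply: contrapT => h; suff e : w = id by move: en; rewrite e inversions_id.
  by apply: (no_desc_id bp) => k hk; apply/negP => partial1; apply: h; exists k.
have [||a sa ea] := IH (w \o s_ k).
- by have := inversions_desc bp hk; rewrite partial1 en => -[->].
- by apply: bounded_perm_comp => //; lia.
by exists (rcons a k); rewrite ?size_rcons ?sa // word_perm_rcons ea comp_s_K.
Qed.

(** Each further letter adds at most one inversion. The window must contain all letters and their
    successors, hence the threshold [p0]. *)
Lemma inversions_word (a : seq int) : exists p0, forall p, (p0 <= p)%N ->
  bounded_perm p (word_perm a) /\ (inversions p (word_perm a) <= size a)%N.
Proof.
elim/last_ind: a => [|a k [p0 IH]].
  exists 0%N => p _ /=; rewrite inversions_id; split=> //; split=> //; by exists id.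
exists (maxn p0 (`|k| + 1)) => p hp.
have [|bp ip] := IH p; first lia.
rewrite word_perm_rcons size_rcons; split; first by apply: bounded_perm_comp => //; lia.
have := @inversions_step p (word_perm a) k.
by case: (desc _ _); case: (_ < _); lia.
Qed.

Lemma word_in_SZ (a : seq int) : in_SZ (word_perm a).
Proof. by have [p0 /(_ p0 (leqnn _)) [bp _]] := inversions_word a; apply/in_SZP; exists p0. Qed.

Lemma inversions_le_word p a : bounded_perm p (word_perm a) -> (inversions p (word_perm a) <= size a)%N.
Proof.
move=> _; have [p0 /(_ (maxn p p0)) []] := inversions_word a; first lia.
by move=> _; apply: leq_trans; apply: inversions_le; lia.
Qed.

(** [word_of_inv] supplies a word of this length and [inversions_le_word] shows that none is
    shorter, so the value chosen in [coxlen] is forced. *)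
Lemma coxlen_inv p w : bounded_perm p w -> coxlen w = inversions p w.
Proof.
move=> bp; have [a sa ea] := word_of_inv bp.
rewrite /coxlen; case: xgetP => [n _ [[b sb eb] mn]|/(_ (inversions p w))]; last first.
  by case; split; [exists a|move=> b eb; rewrite -eb inversions_le_word ?eb].
by apply/eqP; rewrite eqn_leq -{1}sa mn //= -sb -eb inversions_le_word ?eb.
Qed.

Lemma coxlen_step w k : in_SZ w ->
  (coxlen (w \o s_ k) + desc w k = coxlen w + ~~ desc w k)%N.
Proof.
move=> sw; have /in_SZP[p bp] := sw.
have bq : bounded_perm (maxn p (`|k| + 1)) w by apply: bounded_perm_le bp; lia.
rewrite (coxlen_inv bq) (@coxlen_inv (maxn p (`|k| + 1)) (w \o s_ k)); last first.
  by apply: bounded_perm_comp bq; lia.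
rewrite inversions_step; try lia; congr addn.
have := @asc_lt w k (in_SZ_inj sw); rewrite /desc; case: ltgtP => //=.
by move=> _ /(_ isT).
Qed.

Lemma coxlen_desc w k : in_SZ w -> desc w k -> coxlen w = (coxlen (w \o s_ k)).+1.
Proof. by move=> sw partial1; have := coxlen_step k sw; rewrite partial1; lia. Qed.

Lemma coxlen_asc w k : in_SZ w -> ~~ desc w k -> coxlen (w \o s_ k) = (coxlen w).+1.
Proof. by move=> sw /negbTE partial1; have := coxlen_step k sw; rewrite partial1 /=; lia. Qed.

Lemma coxlen_lt w k : in_SZ w -> (coxlen (w \o s_ k) < coxlen w)%N = desc w k.
Proof. by move=> sw; have := coxlen_step k sw; case: desc => /=; lia. Qed.

Lemma coxlen_id : coxlen id = 0%N.
Proof.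
rewrite (@coxlen_inv 0) ?inversions_id //; split=> //; by exists id.
Qed.

Lemma coxlen_word w : in_SZ w -> exists2 a, size a = coxlen w & word_perm a = w.
Proof.
by move=> /in_SZP[p bp]; rewrite (coxlen_inv bp); exact: word_of_inv.
Qed.

Lemma coxlen_le_word a : (coxlen (word_perm a) <= size a)%N.
Proof.
have /in_SZP[p bp] := word_in_SZ a.
by rewrite (coxlen_inv bp) inversions_le_word.
Qed.

Lemma coxlen0 w : in_SZ w -> coxlen w = 0%N -> w = id.
Proof. by move=> /coxlen_word[a <- <-] /size0nil ->. Qed.

(** A crude bound on lengths, for the downward induction from the longest element. *)
Lemma inversions_bound p w : (inversions p w <= size (int_range p) * size (int_range p))%N.
Proof.
have le (F : int -> nat) b : (forall i, F i <= b)%N ->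
    (\sum_(i <- int_range p) F i <= size (int_range p) * b)%N.
  move=> Fb; apply: (@leq_trans (\sum_(i <- int_range p) b)); first exact: leq_sum.
  by rewrite big_const_seq count_predT iter_addn_0 mulnC.
apply: (le) => i; rewrite -[leqRHS]muln1; apply: le => j; exact: leq_b1.
Qed.

(** * Shifts of permutations and of words *)

Lemma shift_permE t w i : shift_perm t w i = w (i - t) + t. Proof. by []. Qed.

Lemma shift_perm0 w : shift_perm 0 w = w.
Proof. by apply/funext => i; rewrite shift_permE subr0 addr0. Qed.

Lemma shift_permD t t' w : shift_perm t (shift_perm t' w) = shift_perm (t' + t) w.
Proof. by apply/funext => i; rewrite !shift_permE; rewrite -addrA; congr (w _ + _); lia. Qed.

Lemma shift_perm_comp t w u : shift_perm t (w \o u) = shift_perm t w \o shift_perm t u.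
Proof. by apply/funext => i; rewrite /= !shift_permE addrK. Qed.

Lemma shift_perm_s t k : shift_perm t (s_ k) = s_ (k + t).
Proof.
apply/funext => i; rewrite shift_permE !s_E.
case: (i - t =P k) => ?; case: (i =P k + t) => ?; try lia.
case: (i - t =P k + 1) => ?; case: (i =P k + t + 1) => ?; lia.
Qed.

Lemma shift_perm_id t : shift_perm t id = id.
Proof. by apply/funext => i; rewrite shift_permE subrK. Qed.

Lemma desc_shift t w k : desc (shift_perm t w) (k + t) = desc w k.
Proof.
rewrite /desc !shift_permE addrK.
have -> : k + t + 1 - t = k + 1 by lia.
by rewrite ltrD2r.
Qed.

Lemma shift_word t (a : seq int) :
  shift_perm t (word_perm a) = word_perm [seq i + t | i <- a].
Proof. by elim: a => [|i a IH] /=; rewrite ?shift_perm_id // shift_perm_comp shift_perm_s IH. Qed.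

Lemma shift_in_SZ t w : in_SZ w -> in_SZ (shift_perm t w).
Proof. by move=> /coxlen_word[a _ <-]; rewrite shift_word; exact: word_in_SZ. Qed.

Lemma coxlen_shift t w : in_SZ w -> coxlen (shift_perm t w) = coxlen w.
Proof.
have le t' u : in_SZ u -> (coxlen (shift_perm t' u) <= coxlen u)%N.
  move=> /coxlen_word[a sa ea]; rewrite -sa -ea shift_word.
  by have := coxlen_le_word [seq i + t' | i <- a]; rewrite size_map.
move=> sw; apply/eqP; rewrite eqn_leq le //=.
have := le (- t) _ (shift_in_SZ t sw).
by rewrite shift_permD subrr shift_perm0.
Qed.

(** * Evaluation and coefficients of polynomials *)

Implicit Types (m : monom).

(* Unfolding [X] makes failing conversion tests explode. *)
HB.lock Definition Xv (i : int) : zpoly := X i.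

Lemma XvE : X = Xv. Proof. by apply/funext => i; rewrite Xv.unlock. Qed.

Lemma Xv_mon i : Xv i = << ucm i >>. Proof. by rewrite -XvE. Qed.

Lemma cmonom_ext (m1 m2 : monom) : (forall i, m1 i = m2 i) -> m1 = m2.
Proof. by move=> h; apply/eqP/cmP. Qed.

Lemma mprodE (r : seq int) (F : int -> monom) i :
  (\big[mmul/mone]_(j <- r) F j) i = (\sum_(j <- r) F j i)%N.
Proof. by elim/big_rec2: _ => [|j n m _ <-]; rewrite ?cm1 ?cmM. Qed.

Lemma ucmX i n j : (\big[mmul/mone]_(l < n) ucm i : monom) j = ((i == j) * n)%N.
Proof.
elim: n => [|n IH]; first by rewrite big_ord0 cm1 muln0.
by rewrite big_ord_recr /= cmM IH cmU; case: eqP => /=; lia.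
Qed.

Lemma malgUM (c d : rat) m1 m2 : (<< c *g m1 >> : zpoly) * << d *g m2 >> = << c * d *g mmul m1 m2 >>.
Proof. exact: fgmulUU. Qed.

Lemma malgU_prod I (r : seq I) (F : I -> monom) :
  (<< \big[mmul/mone]_(j <- r) F j >> : zpoly) = \prod_(j <- r) << F j >>.
Proof. by elim/big_rec2: _ => [|j x m _ <-] //; rewrite malgUM mulr1. Qed.

Lemma monXn i n : Xv i ^+ n = << \big[mmul/mone]_(l < n) ucm i >>.
Proof.
elim: n => [|n IH]; first by rewrite big_ord0 expr0.
rewrite exprSr IH big_ord_recr Xv_mon malgUM.
rewrite mulr1; reflexivity.
Qed.

Lemma monomE m : (<< m >> : zpoly) = \prod_(j <- finsupp m) Xv j ^+ m j.
Proof.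
rewrite (eq_bigr (fun j => << \big[mmul/mone]_(l < m j) ucm j >> : zpoly)); last first.
  by move=> j _; rewrite monXn.
rewrite -malgU_prod; congr << _ >>; apply: cmonom_ext => i; rewrite mprodE.
under eq_bigr => j _ do rewrite ucmX.
case: (finsuppP m i) => [im|im].
  rewrite big1_seq // => j /= jm; case: eqP => // ji; by rewrite -ji jm in im.
by rewrite sum_delta ?fset_uniq //.
Qed.

Lemma monomCE (c : rat) m : (<< c *g m >> : zpoly) = c%:MP * \prod_(j <- finsupp m) Xv j ^+ m j.
Proof. by rewrite -monomE malgUM mulr1 mul1m. Qed.

Lemma zpoly_ind (P : zpoly -> Prop) :
  P 0 -> (forall f g, P f -> P g -> P (f + g)) ->
  (forall c m, P << c *g m >>) -> forall f, P f.
Proof.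
move=> P0 PD PU f; rewrite [f]monalgE.
by elim/big_rec: _ => // m g _ Pg; apply: PD Pg; exact: PU.
Qed.

Lemma zmorph_ext (A : comNzRingType) (a b : {rmorphism zpoly -> A}) :
  (forall c : rat, a c%:MP = b c%:MP) -> (forall i, a (Xv i) = b (Xv i)) -> a =1 b.
Proof.
move=> hc hX; apply: zpoly_ind => [|f g|c m]; rewrite ?rmorph0 // ?rmorphD.
  by move=> -> ->.
rewrite monomCE !rmorphM hc; congr (_ * _); rewrite !rmorph_prod.
by apply: eq_bigr => j _; rewrite !rmorphXn hX.
Qed.

Definition poly_monom_eval (A : comNzRingType) (s : int -> A) (m : monom) : A :=
  \prod_(j <- finsupp m) s j ^+ m j.

Lemma poly_monom_evalEw (A : comNzRingType) (s : int -> A) (d : {fset int}) m : (finsupp m `<=` d)%fset ->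
  poly_monom_eval s m = \prod_(j <- d) s j ^+ m j.
Proof.
move=> sd; rewrite /poly_monom_eval (big_fset_incl _ sd) // => j jd.
by rewrite memNfinsupp => /eqP ->; rewrite expr0.
Qed.

Lemma poly_monom_eval_mmorphism (A : comNzRingType) (s : int -> A) : mmorphism (poly_monom_eval s).
Proof.
split=> [m1 m2|]; last by rewrite /poly_monom_eval mdom1 big_seq_fset0.
rewrite (poly_monom_evalEw s (fsubsetUl (finsupp m1) (finsupp m2))).
rewrite (poly_monom_evalEw s (fsubsetUr (finsupp m1) (finsupp m2))).
rewrite -big_split /= /poly_monom_eval mdomD; apply: eq_bigr => j _.
by rewrite cmM exprD.
Qed.

HB.instance Definition _ (A : comNzRingType) (s : int -> A) :=
  monalg.isMultiplicative.Build monom A (poly_monom_eval s) (poly_monom_eval_mmorphism s).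

HB.lock Definition poly_eval (A : comNzRingType) (h : {rmorphism rat -> A}) (s : int -> A) : zpoly -> A :=
  mmap h (poly_monom_eval s).

Section Esub.
Variables (A : comNzRingType) (h : {rmorphism rat -> A}) (s : int -> A).

Lemma poly_eval_is_additive : additive (poly_eval h s).
Proof. by rewrite poly_eval.unlock; exact: raddfB. Qed.

Lemma poly_eval_is_multiplicative : multiplicative (poly_eval h s).
Proof. by rewrite poly_eval.unlock; split; [exact: rmorphM|exact: rmorph1]. Qed.

HB.instance Definition _ :=
  GRing.isAdditive.Build zpoly A (poly_eval h s) poly_eval_is_additive.
HB.instance Definition _ :=
  GRing.isMultiplicative.Build zpoly A (poly_eval h s) poly_eval_is_multiplicative.

Lemma poly_evalC (c : rat) : poly_eval h s c%:MP = h c.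
Proof. by rewrite poly_eval.unlock mmapC. Qed.

Lemma poly_evalX i : poly_eval h s (Xv i) = s i.
Proof.
rewrite Xv_mon poly_eval.unlock mmapU.
transitivity (1 * poly_monom_eval s (ucm i)); first by congr (_ * _); exact: (rmorph1 h).
by rewrite mul1r /poly_monom_eval mdomU big_seq_fset1 cmUU expr1.
Qed.

Lemma poly_evalU c m : poly_eval h s << c *g m >> = h c * poly_monom_eval s m.
Proof. by rewrite poly_eval.unlock mmapU. Qed.

Lemma poly_evalE f : poly_eval h s f = \sum_(m <- msupp f) h f@_m * poly_monom_eval s m.
Proof. by rewrite poly_eval.unlock. Qed.
End Esub.

(** * Renaming variables and setting variables to zero *)

Notation subst s := (poly_eval (@malgC monom rat) s).

Lemma renameE p : rename p = subst (Xv \o p).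
Proof. by rewrite poly_eval.unlock -XvE. Qed.

Notation ren p := (subst (Xv \o p)).

(** The inverse [q] of [p] is passed along so that exponents are read off directly, without summing
    over fibres of [p]. *)
Definition rename_monom (p q : int -> int) m : monom :=
  (mkcmonom [fsfun i in [fset p j | j in finsupp m]%fset => m (q i) | 0%N])%M.

Lemma rename_monomE p q m i : cancel q p -> rename_monom p q m i = m (q i).
Proof.
move=> qp; rewrite /rename_monom cmE fsfun_fun; case: ifP => // /negbT h.
apply/esym/eqP; rewrite -memNfinsupp; apply: contra h => h.
by apply/imfsetP; exists (q i) => //=; rewrite qp.
Qed.

Lemma rename_monom_finsupp p q m : cancel p q -> cancel q p ->
  finsupp (rename_monom p q m) = [fset p j | j in finsupp m]%fset.
Proof.
move=> pq qp; apply/fsetP => i; rewrite -cmE_neq0 rename_monomE // cmE_neq0.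
apply/idP/imfsetP => [h|[j /= jm ->]]; last by rewrite pq.
by exists (q i) => //=; rewrite qp.
Qed.

Lemma rename_monomK p q m : cancel p q -> cancel q p -> rename_monom q p (rename_monom p q m) = m.
Proof. by move=> pq qp; apply: cmonom_ext => i; rewrite !rename_monomE // pq. Qed.

Lemma rename_monom_mdeg p q m : cancel p q -> cancel q p -> mdeg (rename_monom p q m) = mdeg m.
Proof.
move=> pq qp; rewrite !mdegE rename_monom_finsupp // big_imfset /=; last first.
  by move=> a b _ _; exact: (can_inj pq).
by apply: eq_bigr => j _; rewrite rename_monomE // pq.
Qed.

Lemma renU p q c m : cancel p q -> cancel q p ->
  ren p << c *g m >> = << c *g rename_monom p q m >>.
Proof.
move=> pq qp.
rewrite poly_evalU.
rewrite [RHS]monomCE.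
rewrite (rename_monom_finsupp _ pq qp).
rewrite big_imfset /=; last by move=> a b _ _; exact: (can_inj pq).
congr (_ * _).
by apply: eq_bigr => j _; rewrite rename_monomE //= pq.
Qed.

Lemma ren_coef p q f m : cancel p q -> cancel q p ->
  (ren p f)@_m = f@_(rename_monom q p m).
Proof.
move=> pq qp; elim/zpoly_ind: f => [|f g hf hg|c m'].
- by rewrite rmorph0 !mcoeff0.
- by rewrite rmorphD !mcoeffD hf hg.
rewrite (renU _ _ pq qp) !mcoeffU; congr (_ *+ _).
case: eqP => [<-|h]; first by rewrite rename_monomK // eqxx.
by case: eqP => // e; case: h; rewrite e rename_monomK.
Qed.

Notation kill P := (subst (fun j => if P j then 0 else Xv j)).

Lemma kill_coef P f m :
  (kill P f)@_m = if has P (finsupp m) then 0 else f@_m.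
Proof.
elim/zpoly_ind: f => [|f g hf hg|c m'].
- by rewrite rmorph0 !mcoeff0 if_same.
- by rewrite rmorphD !mcoeffD hf hg; case: ifP => // _; rewrite addr0.
rewrite poly_evalU /poly_monom_eval.
have [/hasP[j jm Pj]|h] := boolP (has P (finsupp m')).
  rewrite (big_rem j) //= Pj expr0n.
  have -> : (m' j == 0%N) = false by apply/negbTE; rewrite cmE_neq0.
  rewrite mul0r mulr0 mcoeff0 mcoeffU.
  case: eqP => [<-|_]; last by rewrite mulr0n if_same.
  by have -> : has P (finsupp m') by apply/hasP; exists j.
rewrite (_ : \prod_(j <- _) _ = \prod_(j <- finsupp m') Xv j ^+ m' j).
  rewrite -monomCE mcoeffU; case: eqP => [<-|]; last by rewrite mulr0n if_same.
  by rewrite (negbTE h).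
apply: eq_big_seq => j jm; case: ifP => [Pj|_]; last by [].
by case/hasP: h; exists j.
Qed.

Lemma mulU_coef m1 m2 (f : zpoly) : (<< m1 >> * f)@_(mmul m1 m2) = f@_m2.
Proof.
elim/zpoly_ind: f => [|f g hf hg|c m'].
- by rewrite mulr0 !mcoeff0.
- by rewrite mulrDr mcoeffD [RHS]mcoeffD; apply: (f_equal2 +%R).
rewrite malgUM mul1r !mcoeffU; congr (_ *+ _).
case: eqP => [e|h]; last first.
  by case: eqP => // e; case: h; rewrite e.
suff -> : m' = m2 by rewrite eqxx.
by apply: cmonom_ext => i; apply: (@addnI (m1 i)); rewrite -!cmM e.
Qed.

Lemma mulXU_coef i (f : zpoly) m : (Xv i * f)@_(mmul (ucm i) m) = f@_m.
Proof. by rewrite Xv_mon mulU_coef. Qed.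

Lemma mulX_coef i (f : zpoly) m :
  (Xv i * f)@_m = if m i == 0%N then 0 else f@_(divcm m (ucm i)).
Proof.
have [mi|mi] := eqVneq (m i) 0%N.
  apply/eqP/negPn; rewrite mcoeff_neq0; apply/negP => /msuppM_le[m1 [m2 []]].
  rewrite Xv_mon msuppU1 in_fset1 => /eqP -> _ e.
  by move: mi; rewrite e cmM cmUU.
have e : m = mmul (ucm i) (divcm m (ucm i)).
  by apply: cmonom_ext => j; rewrite cmM divcmE cmU; case: eqP => [<-|_]; lia.
by rewrite {1}e mulXU_coef.
Qed.

(** * An opaque copy of the polynomial ring *)

Lemma iso_of_eq (A B : comNzRingType) (e : A = B) :
  {a : {rmorphism A -> B} & {b : {rmorphism B -> A} | cancel a b /\ cancel b a}}.
Proof. by case: B / e; exists idfun; exists idfun. Qed.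

(* A sealed copy of [zpoly]: on [zpoly] itself, failing conversion tests unfold
   the whole implementation of monoid algebras. *)
HB.lock Definition Pol : comNzRingType := {malg rat[{cmonom int}]}.

(** The lock leaves only a propositional equality between [Pol] and the original ring; the ring
    morphisms both ways are transports along it. *)
Definition zof : {rmorphism zpoly -> Pol} := projT1 (iso_of_eq (esym Pol.unlock)).
Definition zto : {rmorphism Pol -> zpoly} := proj1_sig (projT2 (iso_of_eq (esym Pol.unlock))).

Lemma zofK : cancel zof zto. Proof. by case: (proj2_sig (projT2 (iso_of_eq (esym Pol.unlock)))). Qed.
Lemma ztoK : cancel zto zof. Proof. by case: (proj2_sig (projT2 (iso_of_eq (esym Pol.unlock)))). Qed.

Implicit Types (f g : Pol).

Definition zX i : Pol := zof (Xv i).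
HB.lock Definition zC : {rmorphism rat -> Pol} := (zof \o @malgC monom rat)%FUN.

Lemma zCE c : zC c = zof c%:MP. Proof. by rewrite zC.unlock. Qed.
Definition zcoef m f : rat := (zto f)@_m.

Lemma zcoefP f g : (forall m, zcoef m f = zcoef m g) -> f = g.
Proof. by move=> h; rewrite -[f]ztoK -[g]ztoK; congr (zof _); apply/malgP. Qed.

Lemma zcoef0 m : zcoef m 0 = 0.
Proof. by rewrite /zcoef rmorph0 mcoeff0. Qed.

Lemma zcoefD m f g : zcoef m (f + g) = zcoef m f + zcoef m g.
Proof. by rewrite /zcoef rmorphD mcoeffD. Qed.

Lemma zcoefN m f : zcoef m (- f) = - zcoef m f.
Proof. by rewrite /zcoef rmorphN mcoeffN. Qed.

Lemma zcoefB m f g : zcoef m (f - g) = zcoef m f - zcoef m g.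
Proof. by rewrite zcoefD zcoefN. Qed.

Lemma zcoefC m c f : zcoef m (zC c * f) = c * zcoef m f.
Proof. by rewrite /zcoef rmorphM zCE zofK mcoeffCM. Qed.

Lemma zcoef_sum I (r : seq I) (F : I -> Pol) m :
  zcoef m (\sum_(x <- r) F x) = \sum_(x <- r) zcoef m (F x).
Proof. by elim/big_rec2: _ => [|x y z _ <-]; rewrite ?zcoef0 ?zcoefD. Qed.

Lemma zcoef1 m : zcoef m 1 = (m == mone)%:R.
Proof. by rewrite /zcoef rmorph1 mcoeff1. Qed.

Lemma zcoefXU i f m : zcoef (mmul (ucm i) m) (zX i * f) = zcoef m f.
Proof. by rewrite /zcoef rmorphM /= zofK mulXU_coef. Qed.

Lemma zcoefX i f m :
  zcoef m (zX i * f) = if m i == 0%N then 0 else zcoef (divcm m (ucm i)) f.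
Proof. by rewrite /zcoef rmorphM /= zofK mulX_coef. Qed.

Lemma zcoefM_neq0 m f g : zcoef m (f * g) != 0 ->
  exists m1 m2, [/\ zcoef m1 f != 0, zcoef m2 g != 0 & m = mmul m1 m2].
Proof.
rewrite /zcoef rmorphM /= mcoeff_neq0 => /msuppM_le[m1 [m2 [h1 h2 e]]].
by exists m1, m2; rewrite !mcoeff_neq0.
Qed.

Lemma Pol_ind (P : Pol -> Prop) : (forall c, P (zC c)) -> (forall i, P (zX i)) ->
  (forall f g, P f -> P g -> P (f + g)) -> (forall f g, P f -> P g -> P (f * g)) ->
  forall f, P f.
Proof.
move=> PC PX PD PM f; rewrite -[f]ztoK.
elim/zpoly_ind: (zto f) => [|g1 g2 h1 h2|c m].
- by rewrite rmorph0 -(rmorph0 zC).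
- by rewrite rmorphD; apply: PD.
rewrite monomCE rmorphM; apply: (PM); first by rewrite -zCE; exact: PC.
rewrite rmorph_prod; elim/big_rec: _ => [|j x _ Px]; first by rewrite -(rmorph1 zC).
apply: (PM) => //; rewrite rmorphXn /=.
elim: (m j) => [|n IH]; first by rewrite expr0 -(rmorph1 zC).
by rewrite exprS; apply: PM => //; exact: PX.
Qed.

Lemma Pol_ext (A : comNzRingType) (a b : {rmorphism Pol -> A}) :
  (forall c : rat, a (zC c) = b (zC c)) -> (forall i, a (zX i) = b (zX i)) -> a =1 b.
Proof.
move=> hC hX; elim/Pol_ind => // f g hf hg; first by rewrite !rmorphD hf hg.
by rewrite !rmorphM hf hg.
Qed.

Section Zev.
Variables (A : comNzRingType) (h : {rmorphism rat -> A}) (s : int -> A).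
Definition Pol_eval : {rmorphism Pol -> A} := (poly_eval h s \o zto)%FUN.

Lemma Pol_evalC c : Pol_eval (zC c) = h c.
Proof. by rewrite /= zCE zofK poly_evalC. Qed.

Lemma Pol_evalX i : Pol_eval (zX i) = s i.
Proof. by rewrite /= zofK poly_evalX. Qed.

Lemma Pol_evalE f : Pol_eval f = \sum_(m <- msupp (zto f)) h (zcoef m f) * poly_monom_eval s m.
Proof. by rewrite /= poly_evalE. Qed.
End Zev.

Definition zsub (s : int -> Pol) : {rmorphism Pol -> Pol} := Pol_eval zC s.
Definition zren p := zsub (zX \o p).
Definition zkill (P : pred int) := zsub (fun j => if P j then 0 else zX j).

Lemma zsubC s c : zsub s (zC c) = zC c. Proof. exact: Pol_evalC. Qed.
Lemma zsubX s i : zsub s (zX i) = s i. Proof. exact: Pol_evalX. Qed.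
Lemma zrenC p c : zren p (zC c) = zC c. Proof. exact: zsubC. Qed.
Lemma zrenX p i : zren p (zX i) = zX (p i). Proof. exact: zsubX. Qed.
Lemma zkillC P c : zkill P (zC c) = zC c. Proof. exact: zsubC. Qed.
Lemma zkillX P i : zkill P (zX i) = if P i then 0 else zX i. Proof. exact: zsubX. Qed.

Lemma zof_ren p (f : zpoly) : zof (rename p f) = zren p (zof f).
Proof.
have e : zof \o subst (Xv \o p) =1 zren p \o zof.
  apply: zmorph_ext => [c|i]; rewrite /= zofK ?poly_evalX //.
  by rewrite !poly_evalC zCE.
by rewrite renameE; exact: e.
Qed.

Lemma zto_ren p f : zto (zren p f) = rename p (zto f).
Proof. by rewrite -{1}[f]ztoK -zof_ren zofK. Qed.

Lemma zren_coef p q f m : cancel p q -> cancel q p ->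
  zcoef m (zren p f) = zcoef (rename_monom q p m) f.
Proof. by move=> pq qp; rewrite /zcoef zto_ren renameE (ren_coef _ _ pq qp). Qed.

Lemma zto_kill P f : zto (zkill P f) = kill P (zto f).
Proof.
have e : zto \o zkill P =1 kill P \o zto.
  apply: Pol_ext => [c|i]; first by rewrite /= zCE zofK !poly_evalC zCE zofK.
  by rewrite /= zofK !poly_evalX; case: (P i); rewrite ?zofK ?rmorph0.
exact: e.
Qed.

Lemma zkill_coef P f m :
  zcoef m (zkill P f) = if has P (finsupp m) then 0 else zcoef m f.
Proof. by rewrite /zcoef zto_kill kill_coef. Qed.

Lemma zren_comp p q f : zren p (zren q f) = zren (p \o q) f.
Proof.
apply: (@Pol_ext Pol (zren p \o zren q)%FUN) => [c|i]; first by rewrite -[LHS]/(zren p (zren q _)) !zrenC.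
by rewrite -[LHS]/(zren p (zren q _)) !zrenX.
Qed.

Lemma zren_id f : zren id f = f.
Proof. by apply: (@Pol_ext Pol (zren id) idfun) => [c|i]; rewrite ?zrenC ?zrenX. Qed.

(** The coefficient of x_i m in the product is that of m in [f] minus that of x_i m / x_j, where x_j
    has a smaller exponent; induction on this exponent. *)
Lemma zmulXB_eq0 i j f : i != j -> (zX i - zX j) * f = 0 -> f = 0.
Proof.
move=> ij e; apply: zcoefP => m; rewrite zcoef0.
move en : (m j) => n; elim: n m en => [|n IH] m en.
  have := congr1 (zcoef (mmul (ucm i) m)) e.
  rewrite mulrBl zcoefB zcoef0 zcoefXU zcoefX cmM cmU en.
  by rewrite (negbTE ij) /= subr0.
have := congr1 (zcoef (mmul (ucm i) m)) e.
rewrite mulrBl zcoefB zcoef0 zcoefXU zcoefX cmM cmU en (negbTE ij) /=.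
rewrite (IH (divcm _ _)) ?subr0 // divcmE cmM !cmU en (negbTE ij) eqxx; lia.
Qed.

Lemma zmulXB_inj i j f g : i != j -> (zX i - zX j) * f = (zX i - zX j) * g -> f = g.
Proof.
move=> ij /eqP; rewrite -subr_eq0 -mulrBr => /eqP /(zmulXB_eq0 ij) /eqP.
by rewrite subr_eq0 => /eqP.
Qed.

(** * Homogeneous polynomials *)

Definition homog (d : nat) f := forall m, zcoef m f != 0 -> mdeg m = d.

Lemma hom0 d : homog d 0. Proof. by move=> m; rewrite zcoef0 eqxx. Qed.

Lemma homD d f g : homog d f -> homog d g -> homog d (f + g).
Proof.
move=> hf hg m; rewrite zcoefD; have [->|/hf//] := eqVneq (zcoef m f) 0.
by rewrite add0r => /hg.
Qed.

Lemma homM d e f g : homog d f -> homog e g -> homog (d + e) (f * g).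
Proof.
move=> hf hg m /zcoefM_neq0[m1 [m2 [/hf <- /hg <- ->]]]; exact: mdegM.
Qed.

Lemma hom1 : homog 0 1.
Proof. by move=> m; rewrite zcoef1; case: (m =P mone) => [->|]; rewrite ?mdeg1 ?eqxx. Qed.

Lemma homC c : homog 0 (zC c).
Proof. by move=> m; rewrite -[zC c]mulr1 zcoefC mulf_eq0 negb_or => /andP[_ /hom1]. Qed.

Lemma homCM d c f : homog d f -> homog d (zC c * f).
Proof. by move=> hf; rewrite -[d]add0n; apply: homM => //; exact: homC. Qed.

Lemma homB d f g : homog d f -> homog d g -> homog d (f - g).
Proof.
move=> hf hg; apply: homD => //; rewrite -mulN1r -(rmorph1 zC) -rmorphN.
exact: homCM.
Qed.

Lemma homX i : homog 1 (zX i).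
Proof.
move=> m; rewrite -[zX i]mulr1 zcoefX zcoef1; case: (m i =P 0%N) => [_|mi]; rewrite ?eqxx //.
case: (divcm m (ucm i) =P mone) => [e _|]; last by rewrite eqxx.
suff -> : m = ucm i by rewrite mdegU.
apply: cmonom_ext => j; have := congr1 (fun x : monom => x j) e.
by rewrite /= divcmE cm1 cmU; case: eqP mi => [<-|_] /=; lia.
Qed.

Lemma hom_ren p q d f : cancel p q -> cancel q p -> homog d f -> homog d (zren p f).
Proof.
move=> pq qp hf m; rewrite (zren_coef _ _ pq qp) => /hf <-.
by rewrite rename_monom_mdeg.
Qed.

Lemma hom_kill P d f : homog d f -> homog d (zkill P f).
Proof. by move=> hf m; rewrite zkill_coef; case: ifP => [|_ /hf//]; rewrite eqxx. Qed.

(** * Values and first derivatives at the point (1, 1, ...) *)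

Definition eval1 : {rmorphism Pol -> rat} := Pol_eval idfun (fun=> 1).

Lemma eval1C c : eval1 (zC c) = c. Proof. exact: Pol_evalC. Qed.
Lemma eval1X i : eval1 (zX i) = 1. Proof. exact: Pol_evalX. Qed.

(* Coefficient 0 of the image is the value at (1, 1, ...), coefficient 1 the
   derivative in [x_k] there. *)
Definition dual_eval k : {rmorphism Pol -> {poly rat}} :=
  Pol_eval (polyC : {rmorphism rat -> {poly rat}}) (fun j => if j == k then 1 + 'X else 1).

Definition partial1 k f : rat := (dual_eval k f)`_1.

Lemma dual_eval0 k f : (dual_eval k f)`_0 = eval1 f.
Proof.
rewrite -horner_coef0 -[LHS]/((horner_eval 0 \o dual_eval k) f).
apply: (@Pol_ext rat (horner_eval 0 \o dual_eval k)%FUN) => [c|i].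
  by rewrite -[LHS]/((dual_eval k (zC c)).[0]) Pol_evalC eval1C hornerC.
rewrite -[LHS]/((dual_eval k (zX i)).[0]) Pol_evalX eval1X.
by case: eqP => _; rewrite ?hornerD ?hornerX ?hornerC ?addr0.
Qed.

Lemma partial1D k f g : partial1 k (f + g) = partial1 k f + partial1 k g.
Proof. by rewrite /partial1 rmorphD coefD. Qed.

Lemma partial1B k f g : partial1 k (f - g) = partial1 k f - partial1 k g.
Proof. by rewrite /partial1 rmorphB coefB. Qed.

Lemma partial1M k f g : partial1 k (f * g) = partial1 k f * eval1 g + eval1 f * partial1 k g.
Proof.
by rewrite /partial1 rmorphM coefM !big_ord_recr big_ord0 /= add0r subnn subn0 !dual_eval0 addrC.
Qed.

Lemma partial1X k i : partial1 k (zX i) = (i == k)%:R.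
Proof.
by rewrite /partial1 Pol_evalX; case: eqP => _; rewrite ?coefD ?coefX coef1 ?add0r.
Qed.

Lemma partial1_ren k p q f : cancel p q -> cancel q p -> partial1 k (zren p f) = partial1 (q k) f.
Proof.
move=> pq qp; suff E : dual_eval k (zren p f) = dual_eval (q k) f by rewrite /partial1 E.
apply: (@Pol_ext _ (dual_eval k \o zren p)%FUN (dual_eval (q k))) => [c|i].
  by rewrite -[LHS]/(dual_eval k (zren p _)) zrenC !Pol_evalC.
rewrite -[LHS]/(dual_eval k (zren p _)) zrenX !Pol_evalX.
suff -> : (p i == k) = (i == q k) by [].
by apply/eqP/eqP => [<-|->]; rewrite ?pq ?qp.
Qed.

Lemma coef1_expr1X n : ((1 + 'X : {poly rat}) ^+ n)`_1 = n%:R.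
Proof.
have h0 l : ((1 + 'X : {poly rat}) ^+ l)`_0 = 1.
  by rewrite -horner_coef0 horner_exp hornerD hornerX hornerC addr0 expr1n.
elim: n => [|n IH]; first by rewrite expr0 coef1.
rewrite exprS coefM !big_ord_recr big_ord0 /= add0r subnn subn0 IH h0.
by rewrite !coefD !coefX !coef1 /= -natr1; ring.
Qed.

Lemma partial1E k f : partial1 k f = \sum_(m <- msupp (zto f)) zcoef m f * (m k)%:R.
Proof.
rewrite /partial1 Pol_evalE coef_sum; apply: eq_bigr => m _.
rewrite coefCM; congr (_ * _); rewrite -coef1_expr1X; congr (_`_1).
rewrite /poly_monom_eval (eq_bigr (fun j => if j == k then (1 + 'X : {poly rat}) ^+ m k else 1)); last first.
  by move=> j _; case: eqP => [->|_]; rewrite ?expr1n.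
rewrite -big_mkcond /=.
case: (finsuppP m k) => [km|km].
  rewrite big1_seq ?expr0 //= => j /andP[/eqP -> jm]; by rewrite jm in km.
by rewrite -big_filter filter_pred1_uniq ?fset_uniq // big_seq1.
Qed.

Lemma eval1E f : eval1 f = \sum_(m <- msupp (zto f)) zcoef m f.
Proof.
rewrite Pol_evalE; apply: eq_bigr => m _; rewrite /poly_monom_eval big1 ?mulr1 //.
by move=> j _; rewrite expr1n.
Qed.

Lemma mdeg_sum m (r : seq int) : uniq r -> {subset finsupp m <= r} ->
  (\sum_(k <- r) m k)%N = mdeg m.
Proof.
move=> ur sr; rewrite mdegE (bigID (mem (finsupp m))) /= [X in (_ + X)%N]big1 ?addn0; last first.
  by move=> i; rewrite memNfinsupp => /eqP.
rewrite -big_filter; apply: perm_big; apply: uniq_perm; rewrite ?filter_uniq ?fset_uniq //.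
by move=> i; rewrite mem_filter andb_idr // => /sr.
Qed.

(** Euler's identity: each monomial contributes its coefficient times the sum of its exponents,
    which is [d]. The list [r] has to contain every variable that occurs. *)
Lemma zeuler d f (r : seq int) : homog d f -> uniq r ->
  (forall m, zcoef m f != 0 -> {subset finsupp m <= r}) ->
  \sum_(k <- r) partial1 k f = d%:R * eval1 f.
Proof.
move=> hf ur sr; under eq_bigr => k _ do rewrite partial1E.
rewrite exchange_big eval1E mulr_sumr; apply: eq_big_seq => m mf.
have mf' : zcoef m f != 0 by rewrite /zcoef mcoeff_neq0.
by rewrite -mulr_sumr -natr_sum (mdeg_sum ur (sr _ mf')) (hf _ mf') mulrC.
Qed.

(** * The Fomin-Stanley product *)

Section NilCoxeter.
Variable A : comNzRingType.
Implicit Types (phi psi : (int -> int) -> A) (x y z : A) (v : int -> A).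

(* A function [phi] stands for the formal sum of the [phi w * u_w]; this is its
   right multiplication by [u_k]. *)
Definition nil_gen k phi w : A := if desc w k then phi (w \o s_ k) else 0.
Definition nil_factor k x phi w : A := phi w + x * nil_gen k phi w.

Lemma desc_s w k : desc (w \o s_ k) k = (w k < w (k + 1)).
Proof. by rewrite /desc /= s_l s_r. Qed.

(** u_k squares to zero. *)
Lemma nil_factorD k x y phi : nil_factor k x (nil_factor k y phi) = nil_factor k (x + y) phi.
Proof.
apply/funext => w; rewrite /nil_factor /nil_gen desc_s /desc comp_s_K.
by case: ltgtP => _; ring.
Qed.

Lemma nil_factor0 k phi : nil_factor k 0 phi = phi.
Proof. by apply/funext => w; rewrite /nil_factor mul0r addr0. Qed.

Lemma s_comm i j w : j != i -> j != i + 1 -> i != j + 1 -> (w \o s_ i) \o s_ j = (w \o s_ j) \o s_ i.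
Proof.
move=> h1 h2 h3; apply/funext => l /=; congr w; rewrite !s_E.
by case: (l =P i) => ?; case: (l =P j) => ?; case: (l =P i + 1) => ?;
  case: (l =P j + 1) => ?; repeat case: eqP => ?; lia.
Qed.

Lemma desc_far i j w : j != i -> j != i + 1 -> i != j + 1 -> desc (w \o s_ i) j = desc w j.
Proof. by move=> h1 h2 h3; rewrite /desc /= !s_out //; lia. Qed.

Lemma nil_factor_comm i j x y phi : j != i -> j != i + 1 -> i != j + 1 ->
  nil_factor i x (nil_factor j y phi) = nil_factor j y (nil_factor i x phi).
Proof.
move=> h1 h2 h3; apply/funext => w; rewrite /nil_factor /nil_gen !desc_far // 1?eq_sym //.
by rewrite (s_comm w h1 h2 h3); case: desc; case: desc; ring.
Qed.

Lemma s_braid k w : ((w \o s_ k) \o s_ (k + 1)) \o s_ k = ((w \o s_ (k + 1)) \o s_ k) \o s_ (k + 1).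
Proof.
have e1 : s_ (k + 1) k = k by rewrite s_out //; lia.
have e2 : s_ k (k + 1 + 1) = k + 1 + 1 by rewrite s_out //; lia.
apply/funext => l /=; congr w.
have [->|h1] := eqVneq l k; first by rewrite !(s_l, s_r, e1, e2).
have [->|h2] := eqVneq l (k + 1); first by rewrite !(s_l, s_r, e1, e2).
have [->|h3] := eqVneq l (k + 1 + 1); first by rewrite !(s_l, s_r, e1, e2).
have el : s_ k l = l by rewrite s_out.
have el' : s_ (k + 1) l = l by rewrite s_out.
by rewrite !(el, el').
Qed.

(** The Yang-Baxter equation of the nilCoxeter algebra. At a given [w] only the relative order of
    the values at k, k + 1, k + 2 matters, so a case check suffices. *)
Lemma nil_factor_braid k x y phi :
  nil_factor k x (nil_factor (k + 1) (x + y) (nil_factor k y phi)) = nil_factor (k + 1) y (nil_factor k (x + y) (nil_factor (k + 1) x phi)).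
Proof.
apply/funext => w; rewrite /nil_factor /nil_gen /desc /=.
have e1 : s_ (k + 1) k = k by rewrite s_out //; lia.
have e2 : s_ k (k + 1 + 1) = k + 1 + 1 by rewrite s_out //; lia.
rewrite !(s_l, s_r, e1, e2) /= !comp_s_K s_braid.
case: (ltgtP (w (k + 1)) (w k)) => [h1|h1|h1];
case: (ltgtP (w (k + 1 + 1)) (w (k + 1))) => [h2|h2|h2];
case: (ltgtP (w (k + 1 + 1)) (w k)) => [h3|h3|h3]; try (exfalso; lia); ring.
Qed.

(* Right multiplication by (1 + x u_(i+c-1)) ... (1 + x u_(i+1)) (1 + x u_i). *)
Fixpoint nil_row (c : nat) i x phi :=
  if c is c'.+1 then nil_factor i x (nil_row c' (i + 1) x phi) else phi.

Lemma nil_row_nil_factor_comm c i j x y phi : j + 1 < i -> nil_row c i x (nil_factor j y phi) = nil_factor j y (nil_row c i x phi).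
Proof.
elim: c i => //= c IH i ij; rewrite IH; last lia.
by rewrite nil_factor_comm //; lia.
Qed.

(** Yang-Baxter applied after splitting the outermost factor with parameter x into parameters y and
    x - y. It leaves a factor with parameter x - y at i + 1, which [cancel_] absorbs: this is the
    induction hypothesis with an outer factor of parameter y cancelled. *)
Lemma nil_row_comm c i x y phi : nil_row c i x (nil_row c i y phi) = nil_row c i y (nil_row c i x phi).
Proof.
elim: c i x y phi => [|[|c] IH] i x y phi //=.
  by rewrite !nil_factorD addrC.
pose B a := nil_row c (i + 1 + 1) a.
have far a b psi : B a (nil_factor i b psi) = nil_factor i b (B a psi).
  by rewrite /B nil_row_nil_factor_comm //; lia.
have B1 a psi : nil_row c.+1 (i + 1) a psi = nil_factor (i + 1) a (B a psi) by [].
have cancel_ : nil_factor (i + 1) (x - y) (B x (nil_row c.+1 (i + 1) y phi)) = B y (nil_row c.+1 (i + 1) x phi).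
  by rewrite (addrC x) -nil_factorD -B1 (IH (i + 1) x y) B1 nil_factorD addNr nil_factor0.
rewrite -/(nil_row c.+1 (i + 1) y phi) -/(nil_row c.+1 (i + 1) x phi) -/(B x) -/(B y).
have ex : x = y + (x - y) by rewrite addrC subrK.
rewrite !far -cancel_ {1}ex -nil_factorD; congr (nil_factor i y _).
by have := nil_factor_braid i (x - y) y (B x (nil_row c.+1 (i + 1) y phi)); rewrite subrK.
Qed.

(** Dropping the factor 1 + a u_i from a row amounts to multiplying by 1 - a u_i. Both sides thus
    become two full rows, which commute, followed by a factor at i with parameter -x. *)
Lemma nil_row_diff c i x y phi :
  nil_row c (i + 1) x (nil_row c.+1 i y phi) = nil_factor i (y - x) (nil_row c (i + 1) y (nil_row c.+1 i x phi)).
Proof.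
have e a psi : nil_row c (i + 1) a psi = nil_factor i (- a) (nil_row c.+1 i a psi) by rewrite /= nil_factorD addNr nil_factor0.
by rewrite e nil_row_comm (e y) nil_factorD addrAC subrr add0r.
Qed.

Lemma nil_row0 c i phi : nil_row c i 0 phi = phi.
Proof. by elim: c i => //= c IH i; rewrite nil_factor0 IH. Qed.

(** Row i has parameter [v i] and uses the generators from u_i up to an index common to all rows.
    With i = 1 and c = n this is the Fomin-Stanley product for S_n, in u_1, ..., u_(n-1). *)
Fixpoint nil_prod v (c : nat) i phi :=
  if c is c'.+1 then nil_prod v c' (i + 1) (nil_row c' i (v i) phi) else phi.

Lemma nil_prod_nil_factor_comm v c i k x phi : k + 1 < i -> nil_prod v c i (nil_factor k x phi) = nil_factor k x (nil_prod v c i phi).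
Proof.
elim: c i phi => //= c IH i phi ki; rewrite nil_row_nil_factor_comm // IH //; lia.
Qed.

Lemma eq_nil_prod v v' c i phi : (forall j, i <= j < i + c%:Z -> v j = v' j) ->
  nil_prod v c i phi = nil_prod v' c i phi.
Proof.
elim: c i phi => //= c IH i phi h; rewrite h ?IH //; last lia.
by move=> j hj; apply: h; lia.
Qed.

(** Only rows k and k + 1 see the exchange. [nil_row_diff] turns it into a factor at k, which
    commutes with the later rows because their generators have index at least k + 2. *)
Lemma nil_prod_swap v c i k phi : i <= k -> k + 1 < i + c%:Z ->
  nil_prod (v \o s_ k) c i phi = nil_factor k (v (k + 1) - v k) (nil_prod v c i phi).
Proof.
elim: c i phi => [|c IH] i phi ik kc; first lia.
have [->|ik'] := eqVneq i k; last first.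
  by rewrite /= s_out //; try lia; rewrite IH //; lia.
case: c IH kc => [|c] _ kc; first lia.
rewrite /= s_l s_r.
rewrite (@eq_nil_prod (v \o s_ k) v); last by move=> j hj; rewrite /= s_out //; lia.
rewrite -/(nil_row c.+1 k (v (k + 1)) phi) -/(nil_row c.+1 k (v k) phi) nil_row_diff.
by rewrite nil_prod_nil_factor_comm //; lia.
Qed.

End NilCoxeter.

Section MapPhi.
Variables (A B : comNzRingType) (h : {rmorphism A -> B}).

Lemma map_nil_factor k x (phi : (int -> int) -> A) : h \o nil_factor k x phi = nil_factor k (h x) (h \o phi).
Proof.
by apply/funext => w; rewrite /nil_factor /nil_gen /= rmorphD rmorphM; case: desc; rewrite ?rmorph0.
Qed.

Lemma map_nil_row c i x (phi : (int -> int) -> A) : h \o nil_row c i x phi = nil_row c i (h x) (h \o phi).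
Proof. by elim: c i => //= c IH i; rewrite map_nil_factor IH. Qed.

Lemma map_nil_prod v c i (phi : (int -> int) -> A) :
  h \o nil_prod v c i phi = nil_prod (h \o v) c i (h \o phi).
Proof. by elim: c i phi => //= c IH i phi; rewrite IH map_nil_row. Qed.
End MapPhi.

Section ShiftPhi.
Variables (A B : comNzRingType) (h : {rmorphism A -> B}).
Definition shift_rel (phi : (int -> int) -> A) (phi' : (int -> int) -> B) :=
  forall w, phi' (shift_perm 1 w) = h (phi w).

Lemma shift_rel_nil_factor k x phi phi' : shift_rel phi phi' -> shift_rel (nil_factor k x phi) (nil_factor (k + 1) (h x) phi').
Proof.
move=> r w; rewrite /nil_factor /nil_gen desc_shift rmorphD rmorphM r -shift_perm_s -shift_perm_comp.
by case: desc; rewrite ?rmorph0 ?r.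
Qed.

Lemma shift_rel_nil_row c k x phi phi' : shift_rel phi phi' -> shift_rel (nil_row c k x phi) (nil_row c (k + 1) (h x) phi').
Proof. by elim: c k => //= c IH k r; apply: shift_rel_nil_factor; apply: IH. Qed.

Lemma shift_rel_nil_prod v v' c k phi phi' : (forall j, k <= j -> v' (j + 1) = h (v j)) ->
  shift_rel phi phi' -> shift_rel (nil_prod v c k phi) (nil_prod v' c (k + 1) phi').
Proof.
elim: c k phi phi' => //= c IH k phi phi' hv r; apply: IH => [j kj|]; first by apply: hv; lia.
by rewrite hv //; exact: shift_rel_nil_row.
Qed.
End ShiftPhi.

Section Delta.
Variable A : comNzRingType.
Definition delta w : A := (`[< w = id >])%:R.

Lemma delta_id : delta id = 1.
Proof. by rewrite /delta; case: asboolP. Qed.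

Lemma delta_neq w : w <> id -> delta w = 0.
Proof. by rewrite /delta; case: asboolP. Qed.

Lemma delta_shift t w : delta (shift_perm t w) = delta w.
Proof.
rewrite /delta; congr (nat_of_bool _)%:R; apply/asboolP/asboolP => [e|->]; last exact: shift_perm_id.
by rewrite -(shift_perm0 w) -(addrN t) -shift_permD e shift_perm_id.
Qed.
End Delta.

Lemma map_delta (A B : comNzRingType) (h : {rmorphism A -> B}) : h \o @delta A = @delta B.
Proof. by apply/funext => w; rewrite /= rmorph_nat. Qed.

(** * Stability, and Schubert polynomials as coefficients of the product *)

Definition upto (n : nat) w := injective w /\ forall j, n%:Z < j -> w j = j.

Lemma upto_comp n w k : upto n w -> k < n%:Z -> upto n (w \o s_ k).
Proof.
move=> [iw fw] kn; split; first exact: inj_comp (can_inj (s_K k)).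
by move=> j nj /=; rewrite s_out ?fw //; lia.
Qed.

Lemma upto_ndesc n w k : upto n w -> n%:Z <= k -> ~~ desc w k.
Proof.
move=> [iw fw] nk; rewrite /desc (fw (k + 1)); last lia.
rewrite -leNgt; case: (lerP (w k) k) => [|h]; first lia.
by have e : w (w k) = w k; [apply: fw; lia | have := iw _ _ e; lia].
Qed.

Section Stable.
Variable A : comNzRingType.
Definition agree n (phi phi' : (int -> int) -> A) := forall w, upto n w -> phi w = phi' w.

(** The extra factor is the one at u_n, applied first. It contributes nothing at permutations
    without a descent at n, and the other generators of the row do not lead out of this class. *)
Lemma agree_nil_row n c i x phi phi' : i + c%:Z = n%:Z -> agree n phi phi' ->
  agree n (nil_row c.+1 i x phi) (nil_row c i x phi').
Proof.
elim: c i => [|c IH] i ic ag w uw.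
  by rewrite /= /nil_factor /nil_gen (negbTE (upto_ndesc uw _)) ?mulr0 ?addr0 ?ag //; lia.
have ag' := IH (i + 1) _ ag.
rewrite [nil_row c.+1 i x phi']/= -[nil_row c.+2 i x phi]/(nil_factor i x (nil_row c.+1 (i + 1) x phi)) /nil_factor /nil_gen.
rewrite ag' //; try lia; case: ifP => // _.
by rewrite ag' //; try lia; apply: upto_comp => //; lia.
Qed.

Lemma agree_nil_prod n v c i phi phi' : i + c%:Z = n.+1%:Z -> agree n phi phi' ->
  agree n (nil_prod v c.+1 i phi) (nil_prod v c i phi').
Proof.
elim: c i phi phi' => [|c IH] i phi phi' ic ag; first by [].
rewrite [nil_prod v c.+1 i phi']/= -[nil_prod v c.+2 i phi]/(nil_prod v c.+1 (i + 1) (nil_row c.+1 i (v i) phi)).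
by apply: IH; [lia|apply: agree_nil_row => //; lia].
Qed.
End Stable.

Definition schub (n : nat) : (int -> int) -> Pol := nil_prod zX n 1 (@delta Pol).

Lemma upto_le n n' w : (n <= n')%N -> upto n w -> upto n' w.
Proof. by move=> nn [iw fw]; split=> // j nj; apply: fw; lia. Qed.

Lemma schub_stable n n' w : (n <= n')%N -> upto n w -> schub n' w = schub n w.
Proof.
move=> /subnK <-; elim: (n' - n)%N => // d IH uw; rewrite addSn -IH //.
by apply: (@agree_nil_prod Pol (d + n)); [lia| |apply: upto_le uw; lia].
Qed.

(** The divided difference relation in additive form: exchanging x_k and x_(k+1) in the product
    multiplies it by a factor at k, whose effect on the coefficient of [w] is read off. *)
Lemma schub_ren n k w : 1 <= k -> k < n%:Z ->
  zren (s_ k) (schub n w) =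
  schub n w + (zX (k + 1) - zX k) * (if desc w k then schub n (w \o s_ k) else 0).
Proof.
move=> k1 kn.
have e : zren (s_ k) \o schub n = nil_factor k (zX (k + 1) - zX k) (schub n).
  rewrite /schub map_nil_prod map_delta -nil_prod_swap; try lia.
  by congr (nil_prod _ _ _ _); apply/funext => i; exact: zrenX.
by rewrite -[LHS]/((zren (s_ k) \o schub n) w) e.
Qed.

Lemma schub_kill n (P : pred int) w : (forall j, 1 <= j <= n%:Z -> ~~ P j) ->
  zkill P (schub n w) = schub n w.
Proof.
move=> hP.
have e : zkill P \o schub n = schub n.
  rewrite /schub map_nil_prod map_delta; apply: eq_nil_prod => j hj.
  by rewrite -[LHS]/(zkill P (zX j)) zkillX (negbTE (hP _ _)) //; lia.
by rewrite -[LHS]/((zkill P \o schub n) w) e.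
Qed.

(** At x_1 = 0 the first row becomes trivial; the others are the rows of the smaller product with
    generators and variables shifted by one. *)
Lemma schub_shift n w :
  zkill (pred1 1) (schub n.+1 (shift_perm 1 w)) = zren (fun j => j + 1) (schub n w).
Proof.
have e : zkill (pred1 1) \o schub n.+1 = nil_prod (zkill (pred1 1) \o zX) n (1 + 1) (@delta Pol).
  rewrite /schub map_nil_prod map_delta -[LHS]/(nil_prod _ n (1 + 1) (nil_row n 1 (zkill (pred1 1) (zX 1)) _)).
  by rewrite zkillX /= nil_row0.
rewrite -[LHS]/((zkill (pred1 1) \o schub n.+1) _) e.
apply: (@shift_rel_nil_prod Pol Pol (zren (fun j => j + 1)) zX) => [j j1|u].
  rewrite -[LHS]/(zkill (pred1 1) (zX (j + 1))) zkillX zrenX /=.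
  by case: eqP => //; lia.
by rewrite delta_shift /delta rmorph_nat.
Qed.

Definition graded (phi : (int -> int) -> Pol) := forall w, in_SZ w -> homog (coxlen w) (phi w).

Lemma graded_nil_factor k x phi : homog 1 x -> graded phi -> graded (nil_factor k x phi).
Proof.
move=> hx hp w sw; apply: homD; first exact: hp.
rewrite /nil_gen; case: ifP => [partial1|_]; last by rewrite mulr0; exact: hom0.
rewrite (coxlen_desc sw partial1) -add1n; apply: homM => //; apply: hp.
exact: in_SZ_comp.
Qed.

Lemma graded_nil_row c k x phi : homog 1 x -> graded phi -> graded (nil_row c k x phi).
Proof. by move=> hx; elim: c k => //= c IH k hp; apply: graded_nil_factor => //; exact: IH. Qed.

Lemma graded_nil_prod v c k phi : (forall i, homog 1 (v i)) -> graded phi -> graded (nil_prod v c k phi).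
Proof.
by move=> hv; elim: c k phi => //= c IH k phi hp; apply: IH; exact: graded_nil_row.
Qed.

Lemma graded_delta : graded (@delta Pol).
Proof.
move=> w sw; have [->|nw] := pselect (w = id).
  by rewrite delta_id coxlen_id; exact: hom1.
by rewrite delta_neq //; exact: hom0.
Qed.

Lemma schub_hom n w : in_SZ w -> homog (coxlen w) (schub n w).
Proof.
have h : graded (schub n) by apply: graded_nil_prod; [exact: homX|exact: graded_delta].
exact: h.
Qed.

Lemma schub_id n : schub n id = 1.
Proof.
rewrite (@schub_stable 0 n id) //; first exact: delta_id.
by split.
Qed.

(** * The coefficient of the longest element *)

Section TopDegree.
Variable A : comNzRingType.
Implicit Types (phi : (int -> int) -> A) (x : A).

Definition length_le (L : nat) phi := forall w, in_SZ w -> (L < coxlen w)%N -> phi w = 0.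

Lemma length_le_nil_factor L k x phi : length_le L phi -> length_le L.+1 (nil_factor k x phi).
Proof.
move=> h w sw lw; rewrite /nil_factor /nil_gen h //; last lia.
case: ifP => [partial1|_]; last by rewrite mulr0 addr0.
rewrite h ?mulr0 ?addr0 //; first exact: in_SZ_comp.
by have := coxlen_desc sw partial1; lia.
Qed.

Lemma length_le_nil_row L c k x phi : length_le L phi -> length_le (L + c) (nil_row c k x phi).
Proof.
elim: c k => [|c IH] k h; first by rewrite addn0.
by rewrite addnS; apply: length_le_nil_factor; exact: IH.
Qed.

(* moves the value [w i] to position [i + c] *)
Fixpoint move_right (c : nat) i w := if c is c'.+1 then move_right c' (i + 1) (w \o s_ i) else w.

Definition max_upto (c : nat) i w := forall j, i < j <= i + c%:Z -> w j < w i.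

Lemma max_uptoS c i w : max_upto c.+1 i w -> max_upto c (i + 1) (w \o s_ i).
Proof. by move=> h j hj; rewrite /= s_r s_out; [apply: h; lia|lia|lia]. Qed.

Lemma move_right_in_SZ c i w : in_SZ w -> in_SZ (move_right c i w).
Proof. by elim: c i w => //= c IH i w sw; apply: IH; exact: in_SZ_comp. Qed.

Lemma move_right_len c i w : in_SZ w -> max_upto c i w -> coxlen w = (coxlen (move_right c i w) + c)%N.
Proof.
elim: c i w => [|c IH] i w sw h; first by rewrite addn0.
rewrite /= addnS -IH; [|exact: in_SZ_comp|exact: max_uptoS].
by apply: coxlen_desc => //; apply: h; lia.
Qed.

(** At length L + c a contribution must use all c factors of the row, so a single path of descents
    from [w] survives. *)
Lemma nil_row_top L c i x phi w : length_le L phi -> in_SZ w -> coxlen w = (L + c)%N ->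
  max_upto c i w -> nil_row c i x phi w = x ^+ c * phi (move_right c i w).
Proof.
move=> hp; elim: c i w => [|c IH] i w sw lw h; first by rewrite expr0 mul1r.
rewrite /= /nil_factor (@length_le_nil_row L c (i + 1) x phi hp w sw); last by rewrite lw; lia.
have di : desc w i by apply: h; lia.
rewrite /nil_gen di add0r IH ?exprS ?mulrA //; first exact: in_SZ_comp.
  by have := coxlen_desc sw di; lia.
exact: max_uptoS.
Qed.

Lemma move_rightE c i w j : move_right c i w j =
  if (j < i) || (i + c%:Z < j) then w j else if j == i + c%:Z then w i else w (j + 1).
Proof.
elim: c i w => [|c IH] i w /=.
  by rewrite addr0; case: ltgtP => //= ->.
rewrite IH /= s_r !s_E.
repeat case: ifP; try lia; move=> *; congr w; lia.
Qed.

(* decreasing on positions below [i] (and there above all later values),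
   increasing from position [i] on; stage [n + 1] is [w0 n], stage 1 is [id] *)
Definition staged (n : nat) i w :=
  [/\ in_SZ w, (forall j, (j < 1) || (n%:Z < j) -> w j = j),
      (forall a b, 1 <= a -> a < i -> a < b -> b <= n%:Z -> w b < w a) &
      (forall a b, i <= a -> a < b -> b <= n%:Z -> w a < w b)].

Lemma staged_cyc n c i w : 1 <= i -> i + c%:Z = n%:Z -> staged n (i + 1) w ->
  max_upto c i w /\ staged n i (move_right c i w).
Proof.
move=> i1 ic [sw fw dw aw].
have cm : max_upto c i w by move=> j hj; apply: dw; lia.
split=> //; split; first exact: move_right_in_SZ.
- by move=> j hj; rewrite move_rightE ifT ?fw //; lia.
- move=> a b a1 ai ab bn; rewrite !move_rightE ic.
  have -> : (a < i) by [].
  rewrite /=; repeat case: ifP => //=; try lia; move=> *; apply: dw; lia.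
move=> a b ia ab bn; rewrite !move_rightE ic.
have -> /= : (a < i) = false by lia.
have -> /= : (b < i) = false by lia.
have -> /= : (n%:Z < a) = false by lia.
have -> /= : (n%:Z < b) = false by lia.
have -> /= : (a == n%:Z) = false by lia.
case: eqP => [_|h]; first by apply: dw; lia.
by apply: aw; lia.
Qed.

(** The stages form a chain from the identity to w_0. Each row, used in full, raises the length by
    its number of factors and contributes that power of its parameter. Quantifying over all
    permutations at a stage avoids naming the intermediate ones. *)
Lemma nil_prod_top n v c i L P phi w : 1 <= i -> i + c%:Z = n%:Z + 1 ->
  length_le L phi -> (forall u, staged n i u -> coxlen u = L /\ phi u = P) ->
  staged n (n%:Z + 1) w ->
  nil_prod v c i phi w = P * \prod_(j < c) v (i + j%:Z) ^+ (c - j.+1).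
Proof.
elim: c i L P phi => [|c IH] i L P phi i1 ic hL hP sw.
  rewrite big_ord0 mulr1 /=; suff /hP[] : staged n i w by [].
  by have -> : i = n%:Z + 1 by lia.
rewrite big_ord_recl /= addr0 subn1 /= mulrA.
rewrite (IH (i + 1) (L + c)%N (P * v i ^+ c)) //; try lia.
- congr (_ * _); apply: eq_bigr => j _; congr (v _ ^+ _); rewrite /= /bump leq0n; lia.
- exact: length_le_nil_row.
move=> u su; have [|cm sc] := @staged_cyc n c i u i1 _ su; first lia.
have [lc Pc] := hP _ sc; have [su' _ _ _] := su.
have lu : coxlen u = (L + c)%N by rewrite (move_right_len su' cm) lc.
by split=> //; rewrite (nil_row_top _ hL) // Pc mulrC.
Qed.

End TopDegree.

Lemma fix_ndesc w k : injective w -> (forall j, j < 1 -> w j = j) -> k < 1 -> ~~ desc w k.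
Proof.
move=> iw fw k1; rewrite /desc (fw k k1) -leNgt.
case: (lerP k (w (k + 1))) => // h.
by have e : w (w (k + 1)) = w (k + 1); [apply: fw; lia | have := iw _ _ e; lia].
Qed.

Lemma staged1 n w : staged n 1 w -> w = id.
Proof.
case=> [[bw fin] fw _ aw].
have bp : bounded_perm n w by split=> // i hi; apply: fw; lia.
apply: (no_desc_id bp) => k hk.
have [k1|k1] := ltP k 1; first by apply: fix_ndesc k1 => //; [exact: bij_inj|move=> j hj; apply: fw; lia].
by rewrite /desc -leNgt ltW //; apply: aw; lia.
Qed.

Lemma w0_in_SZ n : in_SZ (w0 n).
Proof.
apply/in_SZP; exists n; split.
  have w0K : cancel (w0 n) (w0 n).
    move=> i; rewrite /w0; have [h|/negbTE h] := boolP ((1 <= i) && (i <= n%:Z)).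
      by rewrite ifT; lia.
    by rewrite h.
  by exists (w0 n).
by move=> i hi; rewrite /w0; case: ifP => //; lia.
Qed.

Lemma staged_w0 n : staged n (n%:Z + 1) (w0 n).
Proof.
split; first exact: w0_in_SZ.
- by move=> j hj; rewrite /w0; case: ifP => //; lia.
- move=> a b a1 an ab bn; rewrite /w0 !ifT; lia.
by move=> a b; lia.
Qed.

Lemma schub_w0 n : schub n (w0 n) = \prod_(i < n) zX (i.+1)%:Z ^+ (n - i.+1).
Proof.
rewrite /schub (@nil_prod_top _ n zX n 1 0 1) //; last exact: staged_w0.
- by rewrite mul1r; apply: eq_bigr => i _; congr (zX _ ^+ _); lia.
- by lia.
- by move=> w sw lw; apply: delta_neq => e; rewrite e coxlen_id in lw.
by move=> u /staged1 ->; rewrite coxlen_id delta_id.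
Qed.

(** * Existence and uniqueness of the Schubert family *)

Lemma upto_Sinf u : in_SZ u -> exists n, upto n u.
Proof.
move=> su; have /in_SZP[p [bu fu]] := su; exists p; split; first exact: in_SZ_inj.
by move=> j hj; apply: fu; lia.
Qed.

Lemma Sinf_comp u k : 1 <= k -> in_Sinf u -> in_Sinf (u \o s_ k).
Proof.
move=> k1 [su fu]; split; first exact: in_SZ_comp.
by move=> i i0 /=; rewrite s_out ?fu //; lia.
Qed.

Lemma Sinf_desc u k : in_Sinf u -> desc u k -> 1 <= k.
Proof.
move=> [su fu] partial1; rewrite leNgt; apply/negP => k1.
suff : ~~ desc u k by rewrite partial1.
by apply: fix_ndesc k1; [exact: in_SZ_inj|move=> j j1; apply: fu; lia].
Qed.

(** By stability every admissible number of rows gives the same value, so one may be chosen for each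
    permutation. *)
Definition schub_fam u : zpoly := zto (schub (xget 0%N [set n | upto n u]%classic) u).

Lemma schub_famE n u : upto n u -> schub_fam u = zto (schub n u).
Proof.
move=> un; rewrite /schub_fam; case: xgetP => [n' _ un'|/(_ n)//].
rewrite -(@schub_stable n (maxn n n')) //; last lia.
by rewrite (@schub_stable n' (maxn n n')) //; lia.
Qed.

Lemma XE i : X i = zto (zX i). Proof. by rewrite XvE zofK. Qed.

Lemma schub_fam_family : is_schubert_family schub_fam.
Proof.
split=> [n|u i iu].
  rewrite (@schub_famE n) ?schub_w0; last first.
    by split; [exact: in_SZ_inj (w0_in_SZ n)|move=> j hj; rewrite /w0; case: ifP => //; lia].
  by rewrite rmorph_prod; apply: eq_bigr => i _; rewrite rmorphXn XE.
rewrite coxlen_lt; last by case: iu.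
move=> di; have [n un] := upto_Sinf (proj1 iu).
have i_n : i < n%:Z.
  by rewrite ltNge; apply/negP => h; move: (upto_ndesc un h); rewrite di.
rewrite (schub_famE un) (schub_famE (upto_comp un i_n)) /is_divdiff !XE.
rewrite -zto_ren schub_ren ?di //; last exact: Sinf_desc di.
by rewrite -!rmorphB -rmorphM; congr (zto _); ring.
Qed.

(** [u] preserves {1, ..., n} and decreases strictly there; inductions from both ends squeeze it
    onto n + 1 - i. *)
Lemma all_desc_w0 n u : in_Sinf u -> upto n u ->
  (forall k, 1 <= k < n%:Z -> desc u k) -> u = w0 n.
Proof.
move=> [su fu] [iu gu] du.
have rg i : 1 <= i <= n%:Z -> 1 <= u i <= n%:Z.
  move=> hi; apply/andP; split; rewrite leNgt; apply/negP => h.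
    by have e := fu (u i); have := iu (u i) i (e _); lia.
  by have e := gu (u i); have := iu (u i) i (e _); lia.
have up (m : nat) : (m < n)%N -> u (1 + m%:Z) <= n%:Z - m%:Z.
  elim: m => [|m IH] mn; first by have := rg (1 + 0%N%:Z); lia.
  have := du (1 + m%:Z); rewrite /desc.
  have -> : 1 + m%:Z + 1 = 1 + m.+1%:Z by lia.
  have := IH; lia.
have dn (m : nat) : (m < n)%N -> 1 + m%:Z <= u (n%:Z - m%:Z).
  elim: m => [|m IH] mn; first by have := rg (n%:Z - 0%N%:Z); lia.
  have := du (n%:Z - m.+1%:Z); rewrite /desc.
  have -> : n%:Z - m.+1%:Z + 1 = n%:Z - m%:Z by lia.
  have := IH; lia.
apply/funext => i; rewrite /w0; case: ifP => hi.
  have := up `|(i - 1)%R|%N; have := dn `|(n%:Z - i)%R|%N.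
  have -> : 1 + `|(i - 1)%R|%N%:Z = i by lia.
  have -> : n%:Z - `|(n%:Z - i)%R|%N%:Z = i by lia.
  by lia.
by have [i0|i0] := lerP i 0; [apply: fu|apply: gu; lia].
Qed.

(** Downward induction on length. A permutation other than [w0 n] has an ascent k; the value at the
    longer [u \o s_ k] is known, and its divided difference at k determines the value at [u] because
    X_k - X_(k+1) can be cancelled. *)
Lemma family_schub S n u : is_schubert_family S -> in_Sinf u -> upto n u ->
  S u = zto (schub n u).
Proof.
move=> [S0 SD].
(* Any uniform bound makes [B - coxlen u] usable as the induction measure. *)
have [B hB] : exists B, forall u, in_Sinf u -> upto n u -> (coxlen u <= B)%N.
  exists (size (int_range n) * size (int_range n))%N => v [[bv _] fv] [_ gv].
  rewrite (@coxlen_inv n) ?inversions_bound //; split=> // i hi.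
  by have [i0|i0] := lerP i 0; [apply: fv|apply: gv; lia].
move ed : (B - coxlen u)%N => d; elim: d u ed => [|d IH] u ed iu un.
all: have [all_d|] := pselect (forall k, 1 <= k < n%:Z -> desc u k);
  first by rewrite (all_desc_w0 iu un all_d) S0 schub_w0 rmorph_prod;
           apply: eq_bigr => i _; rewrite rmorphXn XE.
all: move=> /existsNP[k] /not_implyP[hk /negP nk].
all: have [k1 kn] := andP hk.
all: have iu' := Sinf_comp k1 iu; have un' := upto_comp un kn.
all: have lu' := coxlen_asc (proj1 iu) nk; have := hB _ iu' un'; rewrite lu'.
  (* In the base case the ascent would lead to a length above [B]. *)
  by move=> hl; lia.
move=> _; have {}IH := IH (u \o s_ k) _ iu' un'.
have := SD (u \o s_ k) k iu'; rewrite comp_s_K lu' => /(_ (leqnn _)).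
rewrite IH; last by rewrite lu'; lia.
rewrite /is_divdiff !XE -zto_ren schub_ren // comp_s_K.
have -> : desc (u \o s_ k) k.
  by rewrite desc_s; apply: asc_lt nk; case: un.
move=> /(congr1 zof); rewrite rmorphM !rmorphB !ztoK.
rewrite (_ : schub n _ - _ = (zX k - zX (k + 1)) * schub n u); last by ring.
move=> /zmulXB_inj e; rewrite -(e _) ?zofK //; lia.
Qed.

Lemma schubert_schub n u : in_Sinf u -> upto n u -> zof (schubert u) = schub n u.
Proof.
move=> iu un; rewrite (@family_schub _ n) ?ztoK // /schubert.
by case: xgetP => [S _ //|/(_ schub_fam)]; case; exact: schub_fam_family.
Qed.

Lemma schub_supp n u m : zcoef m (schub n u) != 0 -> forall j, j \in finsupp m -> 1 <= j <= n%:Z.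
Proof.
pose P : pred int := fun j => ~~ (1 <= j <= n%:Z).
rewrite -(@schub_kill n P); last by move=> j hj; rewrite negbK.
rewrite zkill_coef; case: ifP => [|/negbT/hasPn h _ j /h]; first by rewrite eqxx.
by rewrite negbK.
Qed.

(** * The recursion for values at 1 *)

Lemma abel_sum (a : nat -> rat) n :
  \sum_(i < n) a i = \sum_(i < n) i.+1%:R * (a i - a i.+1) + n%:R * a n.
Proof.
elim: n => [|n IH]; first by rewrite !big_ord0 mul0r addr0.
by rewrite !big_ord_recr /= IH -natr1; ring.
Qed.

Lemma partial1_schub n k w : 1 <= k -> k < n%:Z ->
  partial1 k (schub n w) - partial1 (k + 1) (schub n w) = if desc w k then eval1 (schub n (w \o s_ k)) else 0.
Proof.
move=> k1 kn; have := congr1 (partial1 k) (schub_ren w k1 kn).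
rewrite (partial1_ren _ _ (s_K k) (s_K k)) s_l partial1D partial1M partial1B !partial1X rmorphB !eval1X eqxx.
have -> : (k + 1 == k) = false by lia.
rewrite -[(nat_of_bool true)%:R]/(1 : rat) -[(nat_of_bool false)%:R]/(0 : rat) => ->.
by case: desc; rewrite ?rmorph0; ring.
Qed.

Lemma macdonald_step n w : in_SZ w -> upto n w ->
  (coxlen w)%:R * eval1 (schub n w) =
  \sum_(i < n) i.+1%:R * (if desc w i.+1%:Z then eval1 (schub n (w \o s_ i.+1%:Z)) else 0).
Proof.
move=> sw un; set f := schub n w.
(* One more row makes the relation between the derivatives in x_k and x_(k+1) available at k = n
   too. *)
have ef : schub n.+1 w = f by apply: schub_stable => //; lia.
pose r : seq int := [seq l.+1%:Z | l <- iota 0 n].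
have ur : uniq r by rewrite map_inj_uniq ?iota_uniq // => a b; lia.
rewrite -(zeuler (schub_hom (n := n) sw) ur); last first.
  move=> m /schub_supp h j /h hj; apply/mapP; exists `|(j - 1)%R|%N; last lia.
  by rewrite mem_iota; lia.
rewrite big_map (_ : iota 0 n = index_iota 0 n) ?big_mkord; last by rewrite /index_iota subn0.
rewrite (abel_sum (fun l => partial1 l.+1%:Z f)).
(* The boundary term of the Abel summation vanishes, since x_(n+1) does not occur in [f]. *)
have -> : partial1 n.+1%:Z f = 0.
  rewrite partial1E big1_seq // => m /andP[_]; rewrite -mcoeff_neq0 -[_@_m]/(zcoef m f) => /schub_supp h.
  suff -> : m n.+1%:Z = 0%N by rewrite mulr0.
  by apply/eqP; rewrite cmE_eq0; apply/negP => /h; lia.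
rewrite mulr0 addr0; apply: eq_bigr => i _; congr (_ * _).
have := @partial1_schub n.+1 i.+1%:Z w; rewrite ef.
have -> : i.+1%:Z + 1 = i.+2%:Z by lia.
have hi := ltn_ord i.
move=> ->; try lia.
case: ifP => // di; congr (eval1 _); apply: schub_stable; first lia.
apply: upto_comp => //; rewrite ltNge; apply/negP => /(upto_ndesc un).
by rewrite di.
Qed.

(** * Elementary symmetric polynomials *)

Implicit Types (h : Pol) (d : nat).

Definition esp (k d : nat) : Pol := zof (elem_sym k d).

Lemma espE (k d : nat) : esp k d = \sum_(J : {set 'I_k} | #|J| == d) \prod_(j in J) zX (j.+1)%:Z.
Proof.
rewrite /esp /elem_sym rmorph_sum; apply: eq_bigr => J _.
by rewrite rmorph_prod XvE.
Qed.

(** The generating function, from which the recursion [espS] is read off. *)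
Lemma esp_gen (k : nat) : (\prod_(j < k) (1 + (zX j.+1%:Z)%:P * 'X) : {poly Pol}) = \poly_(d < k.+1) esp k d.
Proof.
under eq_bigr => j _ do rewrite addrC.
rewrite bigA_distr; apply/polyP => d; rewrite coef_sum coef_poly.
have eJ (J : {set 'I_k}) : \prod_i (if i \in J then (zX (nat_of_ord i).+1%:Z)%:P * 'X else 1)
   = (\prod_(j in J) zX j.+1%:Z)%:P * 'X^#|J| :> {poly Pol}.
  by rewrite -big_mkcond big_split /= rmorph_prod prodr_const.
under eq_bigr => J _ do rewrite eJ coefCM coefXn.
case: ltnP => hd; last first.
  rewrite big1 // => J _.
  have hJ : (#|J| <= k)%N by rewrite -[leqRHS]card_ord; exact: max_card.
  have -> : (d == #|J|) = false by apply/negbTE; rewrite neq_ltn (leq_ltn_trans hJ hd) orbT.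
  by rewrite mulr0.
rewrite espE [RHS]big_mkcond; apply: eq_bigr => J _.
by rewrite eq_sym; case: eqP => _; rewrite ?mulr1 ?mulr0.
Qed.

Lemma esp_big (k d : nat) : (k < d)%N -> esp k d = 0.
Proof.
move=> kd; rewrite espE big1 // => J /eqP eJ.
have : (#|J| <= k)%N by rewrite -[leqRHS]card_ord; exact: max_card.
by rewrite eJ leqNgt kd.
Qed.

Lemma esp_coef (k d : nat) : (\prod_(j < k) (1 + (zX j.+1%:Z)%:P * 'X) : {poly Pol})`_d = esp k d.
Proof. by rewrite esp_gen coef_poly; case: ltnP => // h; rewrite esp_big. Qed.

Lemma esp_k0 (k : nat) : esp k 0 = 1.
Proof.
rewrite -esp_coef; elim: k => [|k IH]; first by rewrite big_ord0 coef1.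
by rewrite big_ord_recr coefM big_ord1 subnn IH mul1r coefD coef1 coefMX addr0.
Qed.

Lemma espS (k d : nat) : esp k.+1 d.+1 = esp k d.+1 + zX k.+1%:Z * esp k d.
Proof.
rewrite -!esp_coef big_ord_recr /= mulrDr mulr1 coefD; congr (_ + _).
by rewrite mulrA coefMX /= mulrC coefCM.
Qed.

Definition squarefree_upto (k : nat) m := all (fun i => (1 <= i <= k%:Z) && (m i == 1%N)) (finsupp m).

Lemma squarefree_uptoP (k : nat) m : reflect (forall i, m i != 0%N -> 1 <= i <= k%:Z /\ m i = 1%N) (squarefree_upto k m).
Proof.
apply: (iffP allP) => h i; first by rewrite cmE_neq0 => /h /andP[-> /eqP].
by rewrite -cmE_neq0 => /h[-> ->].
Qed.

Lemma squarefree_upto1 (k : nat) : squarefree_upto k mone.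
Proof. by apply/squarefree_uptoP => i; rewrite cm1. Qed.

(** This has the same shape as [back_esym], which makes truncation a comparison of conditions on
    monomials; it also yields the symmetry [esp_sym]. *)
Lemma zcoef_esp (k d : nat) m : zcoef m (esp k d) = ((mdeg m == d) && squarefree_upto k m)%:R.
Proof.
elim: k d m => [|k IH] [|d] m.
- rewrite esp_k0 zcoef1 mdeg_eq0; case: (m =P mone) => [->|] //.
  by rewrite squarefree_upto1.
- rewrite esp_big // zcoef0; have [/eqP md|//] := boolP (mdeg m == d.+1).
  case: squarefree_uptoP => // h; exfalso; suff e : m = mone by rewrite e mdeg1 in md.
  by apply: cmonom_ext => i; rewrite cm1; apply/eqP; apply/negPn/negP => /h; lia.
- rewrite esp_k0 zcoef1 mdeg_eq0; case: (m =P mone) => [->|] //.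
  by rewrite squarefree_upto1.
rewrite espS zcoefD zcoefX !IH.
have [mk|mk] := eqVneq (m k.+1%:Z) 0%N.
  rewrite addr0; congr (nat_of_bool (_ && _))%:R.
  apply/squarefree_uptoP/squarefree_uptoP => h i mi; have [hi ->] := h i mi; split=> //; first lia.
  have : i <> k.+1%:Z by move=> e; rewrite e mk in mi.
  lia.
have -> : squarefree_upto k m = false by apply/negbTE/squarefree_uptoP => /(_ _ mk); lia.
rewrite andbF add0r; congr (nat_of_bool _)%:R.
have em : m = mmul (ucm k.+1%:Z) (divcm m (ucm k.+1%:Z)).
  by apply: cmonom_ext => j; rewrite cmM divcmE cmU; case: (k.+1%:Z =P j) => [<-|_]; lia.
congr (_ && _); first by rewrite [in RHS]em mdegM mdegU; apply/eqP/eqP; lia.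
apply/squarefree_uptoP/squarefree_uptoP => h i.
  move=> mi; have := h i; have := h k.+1%:Z; rewrite !divcmE !cmU eqxx.
  case: (k.+1%:Z =P i) => [<-|_]; first by move=> + _; lia.
  by rewrite subn0 => _ /(_ mi); lia.
rewrite divcmE cmU; have := h i; case: (k.+1%:Z =P i) => [<-|ni]; first by move=> /(_ mk); lia.
by rewrite subn0 => h' /h'; lia.
Qed.

Lemma esp_homog (k d : nat) : homog d (esp k d).
Proof. by move=> m; rewrite zcoef_esp; case: (mdeg m =P d) => //= _; rewrite eqxx. Qed.

(** For i < k both exchanged variables occur, for i > k neither does; only i = k separates them. *)
Lemma esp_sym (k d : nat) i : 1 <= i -> i != k%:Z -> zren (s_ i) (esp k d) = esp k d.
Proof.
move=> i1 ik; apply: zcoefP => m; rewrite (zren_coef _ _ (s_K i) (s_K i)) !zcoef_esp.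
rewrite (rename_monom_mdeg _ (s_K i) (s_K i)); congr (nat_of_bool (_ && _))%:R.
have h1 m' : squarefree_upto k m' -> squarefree_upto k (rename_monom (s_ i) (s_ i) m').
  move=> /squarefree_uptoP h; apply/squarefree_uptoP => j; rewrite (rename_monomE _ _ (s_K i)) => /h[hj ->]; split=> //.
  by move: hj; rewrite s_E; case: eqP => [->|_]; [lia|case: eqP => [->|_]; lia].
apply/idP/idP => [/h1|]; last exact: h1.
by rewrite (rename_monomK _ (s_K i) (s_K i)).
Qed.

Lemma esp_eval1 (k d : nat) : eval1 (esp k d) = 'C(k, d)%:R.
Proof.
elim: k d => [|k IH] [|d]; rewrite ?esp_k0 ?rmorph1 ?bin0 //.
  by rewrite esp_big // rmorph0.
by rewrite espS rmorphD rmorphM eval1X !IH mul1r binS natrD.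
Qed.

Notation incr := (fun j : int => j + 1).
Notation decr := (fun j : int => j - 1).
Notation kill1 := (zkill (pred1 (1 : int))).

Lemma incrK : cancel incr decr. Proof. by move=> j /=; lia. Qed.
Lemma decrK : cancel decr incr. Proof. by move=> j /=; lia. Qed.

Lemma esp_kill1 (k d : nat) : kill1 (esp k.+1 d) = zren incr (esp k d).
Proof.
elim: k d => [|k IH] [|d]; rewrite ?esp_k0 ?rmorph1 //.
  by rewrite espS rmorphD rmorphM zkillX /= mul0r addr0 esp_big ?rmorph0.
rewrite espS rmorphD rmorphM zkillX (_ : pred1 1 k.+2%:Z = false) // !IH [in RHS]espS rmorphD rmorphM zrenX.
by have -> : k.+1%:Z + 1 = k.+2%:Z by lia.
Qed.

(** * Polynomials symmetric in their first variables *)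

Definition pos_supp f := forall m, zcoef m f != 0 -> forall j, m j != 0%N -> 1 <= j.

Lemma pos_suppD f g : pos_supp f -> pos_supp g -> pos_supp (f + g).
Proof.
move=> hf hg m; rewrite zcoefD; have [->|/hf//] := eqVneq (zcoef m f) 0.
by rewrite add0r => /hg.
Qed.

Lemma pos_suppM f g : pos_supp f -> pos_supp g -> pos_supp (f * g).
Proof.
move=> hf hg m /zcoefM_neq0[m1 [m2 [/hf h1 /hg h2 ->]]] j; rewrite cmM addn_eq0 negb_and.
by case/orP => [/h1|/h2].
Qed.

Lemma pos_suppC c : pos_supp (zC c).
Proof.
move=> m; rewrite -[zC c]mulr1 zcoefC zcoef1; case: (m =P mone) => [-> _ j|_].
  by rewrite cm1.
by rewrite mulr0 eqxx.
Qed.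

Lemma pos_suppCM c f : pos_supp f -> pos_supp (zC c * f).
Proof. by move=> hf; apply: pos_suppM => //; exact: pos_suppC. Qed.

Lemma pos_suppB f g : pos_supp f -> pos_supp g -> pos_supp (f - g).
Proof.
move=> hf hg; apply: pos_suppD => //; rewrite -mulN1r -(rmorph1 zC) -rmorphN.
exact: pos_suppCM.
Qed.

Lemma pos_supp_esp (k d : nat) : pos_supp (esp k d).
Proof.
move=> m; rewrite zcoef_esp; case: squarefree_uptoP => [h|]; last by rewrite andbF eqxx.
by move=> _ j /h; lia.
Qed.

(** The graded algebra generated by the e_a(x_1, ..., x_k) with k >= M; the degree is carried along
    so that straightening can preserve it. *)
Inductive esp_alg (M : nat) : nat -> Pol -> Prop :=
| esp_alg0 d : esp_alg M d 0
| esp_algC c : esp_alg M 0 (zC c)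
| esp_algE (k : nat) d : (M <= k)%N -> esp_alg M d (esp k d)
| esp_algD d f g : esp_alg M d f -> esp_alg M d g -> esp_alg M d (f + g)
| esp_algM d e f g : esp_alg M d f -> esp_alg M e g -> esp_alg M (d + e) (f * g).

Lemma esp_alg_homog M d f : esp_alg M d f -> homog d f.
Proof.
elim=> *; [exact: hom0|exact: homC|exact: esp_homog|exact: homD|exact: homM].
Qed.

Lemma esp_alg_pos_supp M d f : esp_alg M d f -> pos_supp f.
Proof.
elim=> *; [|exact: pos_suppC|exact: pos_supp_esp|exact: pos_suppD|exact: pos_suppM].
by move=> m; rewrite zcoef0 eqxx.
Qed.

Lemma esp_alg_sym M d f i : 1 <= i -> i < M%:Z -> esp_alg M d f -> zren (s_ i) f = f.
Proof.
move=> i1 iM; elim=> *.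
- by rewrite rmorph0.
- by rewrite zrenC.
- by apply: esp_sym => //; lia.
- by rewrite rmorphD; congr (_ + _).
- by rewrite rmorphM; congr (_ * _).
Qed.

Lemma esp_algCM M d c f : esp_alg M d f -> esp_alg M d (zC c * f).
Proof. by move=> h; rewrite -[d]add0n; apply: esp_algM => //; exact: esp_algC. Qed.

(** On generators the lift raises [k] by one, since setting x_1 = 0 in e_a(x_1, ..., x_(k+1)) leaves
    e_a(x_2, ..., x_(k+1)). *)
Lemma esp_alg_lift M d g : esp_alg M d g ->
  exists2 g', esp_alg M.+1 d g' & kill1 g' = zren incr g.
Proof.
elim=> {d g} [d|c|k d Mk|d f g _ [f' hf ef] _ [g' hg eg]|d e f g _ [f' hf ef] _ [g' hg eg]].
- by exists 0; [exact: esp_alg0|rewrite !rmorph0].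
- by exists (zC c); [exact: esp_algC|rewrite zkillC zrenC].
- by exists (esp k.+1 d); [exact: esp_algE|exact: esp_kill1].
- by exists (f' + g'); [exact: esp_algD|rewrite !rmorphD ef eg].
by exists (f' * g'); [exact: esp_algM|rewrite !rmorphM ef eg].
Qed.

HB.lock Definition zmon (m : monom) : Pol := zof << m >>.

Lemma zmon_coef m1 m2 f : zcoef (mmul m1 m2) (zmon m1 * f) = zcoef m2 f.
Proof. by rewrite /zcoef rmorphM zmon.unlock zofK mulU_coef. Qed.

Lemma zmonM m1 m2 : zmon (mmul m1 m2) = zmon m1 * zmon m2.
Proof. by rewrite zmon.unlock -rmorphM malgUM mulr1. Qed.

Lemma zmonE m : zmon m = \prod_(j <- finsupp m) zX j ^+ m j.
Proof. by rewrite zmon.unlock monomE rmorph_prod; apply: eq_bigr => j _; rewrite rmorphXn. Qed.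

Lemma zmonU i : zmon (ucm i) = zX i.
Proof. by rewrite zmon.unlock -Xv_mon. Qed.

Lemma zmon_expand f : f = \sum_(m <- msupp (zto f)) zC (zcoef m f) * zmon m.
Proof.
rewrite -{1}[f]ztoK [zto f in LHS]monalgE rmorph_sum; apply: eq_bigr => m _.
by rewrite zmon.unlock zCE -rmorphM mul_malgC -[in RHS]mul_malgC malgUM mulr1 mul1m.
Qed.

Lemma zmon_dvd m1 h : (forall m, zcoef m h != 0 -> exists m', m = mmul m1 m') ->
  exists q, h = zmon m1 * q.
Proof.
move=> hm; rewrite [h]zmon_expand big_seq.
elim/big_rec: _ => [|m f mh [q ->]]; first by exists 0; rewrite mulr0.
have [m' ->] : exists m', m = mmul m1 m' by apply: hm; rewrite /zcoef mcoeff_neq0.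
exists (zC (zcoef (mmul m1 m') h) * zmon m' + q).
by rewrite zmonM mulrDr mulrCA.
Qed.

Lemma zmon_inj m1 f g : zmon m1 * f = zmon m1 * g -> f = g.
Proof. by move=> e; apply: zcoefP => m; rewrite -(zmon_coef m1) e zmon_coef. Qed.

Definition full_monom (K : nat) : monom := \big[mmul/mone]_(j < K) ucm (j.+1)%:Z.

Lemma full_monomE K i : full_monom K i = (1 <= i <= K%:Z) :> nat.
Proof.
rewrite /full_monom; elim: K => [|K IH]; first by rewrite big_ord0 cm1; lia.
by rewrite big_ord_recr /= cmM IH cmU; case: eqP; lia.
Qed.

Lemma esp_kk K : esp K K = zmon (full_monom K).
Proof.
elim: K => [|K IH]; first by rewrite esp_k0 /full_monom big_ord0 zmon.unlock rmorph1.
by rewrite espS esp_big // add0r IH /full_monom big_ord_recr /= zmonM zmonU mulrC.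
Qed.

(** A monomial free of x_1 would survive at x_1 = 0; symmetry carries the conclusion from x_1 to
    x_2, ..., x_K in turn. *)
Lemma all_vars (K : nat) h : (forall i, 1 <= i < K%:Z -> zren (s_ i) h = h) ->
  kill1 h = 0 -> forall m, zcoef m h != 0 -> forall l : nat, (l < K)%N -> m l.+1%:Z != 0%N.
Proof.
move=> hs hk m mh l; elim: l m mh => [|l IH] m mh lK.
  apply: contraNneq mh => m1; rewrite -(zcoef0 m) -hk zkill_coef ifF //.
  by apply/hasPn => j; rewrite -cmE_neq0 /=; apply: contraNneq => ->; rewrite m1.
have hl : 1 <= l.+1%:Z < K%:Z by lia.
have := IH (rename_monom (s_ l.+1%:Z) (s_ l.+1%:Z) m); rewrite (rename_monomE _ _ (s_K _)) s_l.
have -> : l.+1%:Z + 1 = l.+2%:Z by lia.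
by apply; [rewrite -(zren_coef _ _ (s_K _) (s_K _)) hs | lia].
Qed.

Lemma mdeg_full (K : nat) m : (forall l : nat, (l < K)%N -> m l.+1%:Z != 0%N) ->
  exists2 m', m = mmul (full_monom K) m' & mdeg m = (K + mdeg m')%N.
Proof.
move=> h; have e : m = mmul (full_monom K) (divcm m (full_monom K)).
  apply: cmonom_ext => i; rewrite cmM divcmE full_monomE.
  case: (boolP (1 <= i <= K%:Z)) => hi /=; last lia.
  have e : (`|(i - 1)%R|%N.+1)%:Z = i by lia.
  have mi : m i != 0%N by rewrite -e; apply: h; lia.
  by rewrite subnKC // lt0n.
exists (divcm m (full_monom K)) => //; rewrite {1}e mdegM; congr addn.
rewrite /full_monom; elim: (K) => [|n IH]; first by rewrite big_ord0 mdeg1.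
by rewrite big_ord_recr /= mdegM IH mdegU addn1.
Qed.

(** x_j is the difference of e_1(x_1, ..., x_j) and e_1(x_1, ..., x_(j-1)). *)
Lemma esp_alg0_mon m : (forall j, m j != 0%N -> 1 <= j) -> esp_alg 0 (mdeg m) (zmon m).
Proof.
move=> hm; rewrite zmonE mdegE.
have : forall j, j \in enum_fset (finsupp m) -> 1 <= j by move=> j jm; apply: hm; rewrite cmE_neq0.
elim: (enum_fset (finsupp m)) => [|j r IH] hr.
  by rewrite !big_nil -(rmorph1 zC); exact: esp_algC.
rewrite !big_cons; apply: esp_algM; last by apply: IH => i ir; apply: hr; rewrite inE ir orbT.
have gX : esp_alg 0 1 (zX j).
  have j1 : 1 <= j by apply: hr; rewrite inE eqxx.
  have -> : zX j = esp `|j|%N 1 + zC (- 1) * esp (`|j|%N.-1) 1.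
    have -> : `|j|%N = (`|j|%N.-1).+1 by lia.
    rewrite espS esp_k0 mulr1 /= rmorphN rmorph1; have -> : (`|j|%N.-1.+1)%:Z = j by lia.
    by ring.
  by apply: esp_algD; [exact: esp_algE|apply: esp_algCM; exact: esp_algE].
elim: (m j) => [|n IHn]; first by rewrite expr0 -(rmorph1 zC); exact: esp_algC.
by rewrite exprS -add1n; apply: esp_algM.
Qed.

Lemma kill1_sym i f : 1 <= i -> zren (s_ (i + 1)) (kill1 f) = kill1 (zren (s_ (i + 1)) f).
Proof.
move=> i1; apply: (@Pol_ext Pol (zren (s_ (i + 1)) \o kill1)%FUN (kill1 \o zren (s_ (i + 1)))%FUN) => [c|j].
  rewrite -[LHS]/(zren _ (kill1 _)) -[RHS]/(kill1 (zren _ _)).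
  by rewrite zkillC !zrenC zkillC.
rewrite -[LHS]/(zren _ (kill1 _)) -[RHS]/(kill1 (zren _ _)).
rewrite zrenX !zkillX.
have -> : pred1 1 (s_ (i + 1) j) = pred1 1 j.
  rewrite /= s_E; case: (j =P i + 1) => ?; [|case: (j =P i + 1 + 1) => ?]; lia.
by case: ifP => _; rewrite ?rmorph0 ?zrenX.
Qed.

(* Setting [x_1 = 0] and shifting leaves a polynomial symmetric in one variable
   less; once a lift of it is subtracted from [f], what remains is divisible by
   [e_(M+1)(x_1, ..., x_(M+1))], with a quotient of smaller degree. *)
Lemma esp_alg_of_sym M d f : homog d f -> pos_supp f ->
  (forall i, 1 <= i < M%:Z -> zren (s_ i) f = f) -> esp_alg M d f.
Proof.
elim: M d f => [|M IHM] d f hf pf sf.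
  rewrite [f]zmon_expand big_seq; elim/big_rec: _ => [|m g mf hg]; first exact: esp_alg0.
  have mf' : zcoef m f != 0 by rewrite /zcoef mcoeff_neq0.
  apply: esp_algD => //; apply: esp_algCM; rewrite -(hf _ mf'); apply: esp_alg0_mon.
  exact: pf.
elim/ltn_ind: d f hf pf sf => d IHd f hf pf sf.
pose g := zren decr (kill1 f).
have gg : esp_alg M d g.
  apply: IHM.
  - by apply: (hom_ren decrK incrK); exact: hom_kill.
  - move=> m; rewrite (zren_coef _ _ decrK incrK) zkill_coef.
    case: ifP => [_|/negbT/hasPn hm mf j mj]; first by rewrite eqxx.
    have mj' : rename_monom incr decr m (j + 1) != 0%N by rewrite (rename_monomE _ _ decrK) addrK.
    have := pf _ mf _ mj'; have := hm (j + 1); rewrite -cmE_neq0 mj' /= => /(_ isT).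
    by lia.
  move=> i hi; rewrite /g zren_comp.
  have -> : s_ i \o decr = decr \o s_ (i + 1).
    apply/funext => j; rewrite /= !s_E.
    by case: (j =P i + 1) => ?; case: (j - 1 =P i) => ?; try lia;
       case: (j =P i + 1 + 1) => ?; case: (j - 1 =P i + 1) => ?; lia.
  rewrite -zren_comp kill1_sym; last lia.
  by rewrite sf //; lia.
have [g' gg' eg'] := esp_alg_lift gg.
have eg : kill1 g' = kill1 f.
  rewrite eg' /g zren_comp; have -> : incr \o decr = id by apply/funext => j /=; lia.
  exact: zren_id.
pose h := f - g'.
have hh_ : homog d h by apply: homB => //; exact: esp_alg_homog gg'.
have ph : pos_supp h by apply: pos_suppB => //; exact: esp_alg_pos_supp gg'.
have sh i : 1 <= i < M.+1%:Z -> zren (s_ i) h = h.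
  move=> hi; rewrite /h rmorphB sf //; congr (_ - _).
  by apply: esp_alg_sym gg'; lia.
have kh : kill1 h = 0 by rewrite /h rmorphB eg subrr.
have av := all_vars sh kh.
suff : esp_alg M.+1 d h by move=> hgen; rewrite -[f](subrK g'); apply: esp_algD.
have [q eq_] : exists q, h = zmon (full_monom M.+1) * q.
  by apply: zmon_dvd => m mh; have [m' ? _] := mdeg_full (av m mh); exists m'.
have qh m : zcoef m q = zcoef (mmul (full_monom M.+1) m) h by rewrite eq_ zmon_coef.
have fullsym i : 1 <= i < M.+1%:Z -> zren (s_ i) (zmon (full_monom M.+1)) = zmon (full_monom M.+1).
  by move=> hi; rewrite -esp_kk; apply: esp_sym; lia.
have dfull : mdeg (full_monom M.+1) = M.+1.
  apply: (@esp_homog M.+1 M.+1); rewrite esp_kk -[zmon _]mulr1.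
  by rewrite -{1}[full_monom _]mulm1 zmon_coef zcoef1 eqxx oner_eq0.
(* A nonzero [h] would have degree at least M + 1. *)
have [dM|dM] := ltnP d M.+1.
  have -> : h = 0; last exact: esp_alg0.
  apply: zcoefP => m; rewrite zcoef0; apply/eqP/negPn/negP => mh.
  by have [m' _ e] := mdeg_full (av m mh); have := hh_ _ mh; lia.
have -> : d = (M.+1 + (d - M.+1))%N by lia.
rewrite eq_ -esp_kk; apply: esp_algM; first exact: esp_algE.
apply: IHd; first lia.
- by move=> m; rewrite qh => /hh_; rewrite mdegM dfull; lia.
- move=> m; rewrite qh => /ph hm j mj; apply: hm; rewrite cmM; lia.
(* Symmetry passes to the quotient because x_1 ... x_(M+1) is itself symmetric and can be
   cancelled. *)
move=> i hi; apply: (@zmon_inj (full_monom M.+1)).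
by rewrite -{1}(fullsym i hi) -rmorphM -eq_ sh.
Qed.

(** * Straightening products of elementary symmetric polynomials *)

Section Straightening.
Implicit Types (l : seq (nat * nat)) (e M a b : nat) (al : sem_index).

Definition esp_word l : Pol := \prod_(p <- l) esp p.1 p.2.
Definition word_deg l : nat := \sum_(p <- l) p.2.
(** Strictly increasing levels: each level occurs at most once, so that a word encodes an index
    ([idx_of]). *)
Fixpoint word_ok M l := if l is (k, a) :: l' then (M <= k)%N && word_ok k.+1 l' else true.

Lemma esp_word_cons (k : nat) a l : esp_word ((k, a) :: l) = esp k a * esp_word l.
Proof. by rewrite /esp_word big_cons. Qed.

Lemma word_deg_cons (k : nat) a l : word_deg ((k, a) :: l) = (a + word_deg l)%N.
Proof. by rewrite /word_deg big_cons. Qed.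

Lemma word_ok_le M M' l : (M <= M')%N -> word_ok M' l -> word_ok M l.
Proof. by case: l => //= -[k a] l h /andP[h1 ->]; rewrite (leq_trans h h1). Qed.

Inductive sem_span M d : Pol -> Prop :=
| sem_span0 : sem_span M d 0
| sem_spanD c l f : word_ok M l -> word_deg l = d -> sem_span M d f -> sem_span M d (zC c * esp_word l + f).

Lemma sem_span_add M d f g : sem_span M d f -> sem_span M d g -> sem_span M d (f + g).
Proof. by move=> hf hg; elim: hf => [|c l f' gl dl _ IH]; rewrite ?add0r // -addrA; apply: sem_spanD. Qed.

Lemma sem_span_CM M d c f : sem_span M d f -> sem_span M d (zC c * f).
Proof.
elim=> [|c' l f' gl dl _ IH]; first by rewrite mulr0; exact: sem_span0.
by rewrite mulrDr mulrA -rmorphM; apply: sem_spanD.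
Qed.

Lemma sem_span_sub M d f g : sem_span M d f -> sem_span M d g -> sem_span M d (f - g).
Proof.
move=> hf hg; apply: sem_span_add => //.
by rewrite -mulN1r -(rmorph1 zC) -rmorphN; exact: sem_span_CM.
Qed.

Lemma sem_span_esp_word M l : word_ok M l -> sem_span M (word_deg l) (esp_word l).
Proof.
by move=> gl; rewrite -[esp_word l]addr0 -[esp_word l]mul1r -(rmorph1 zC); apply: sem_spanD => //; exact: sem_span0.
Qed.

Lemma sem_span_bind M M' d d' g f : (forall l, word_ok M l -> word_deg l = d -> sem_span M' d' (g * esp_word l)) ->
  sem_span M d f -> sem_span M' d' (g * f).
Proof.
move=> h; elim=> [|c l f' gl dl _ IH]; first by rewrite mulr0; exact: sem_span0.
by rewrite mulrDr mulrCA; apply: sem_span_add => //; apply: sem_span_CM; exact: h.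
Qed.

Lemma sem_span_cons M (k : nat) a d f : (M <= k)%N -> sem_span k.+1 d f -> sem_span M (a + d) (esp k a * f).
Proof.
move=> Mk; apply: sem_span_bind => l gl <-.
by rewrite -esp_word_cons -(word_deg_cons k); apply: sem_span_esp_word; rewrite /= Mk.
Qed.

(* Eliminate [x_(k+1)] between the recurrences for [e_(a+1)] and [e_(b+1)]. *)
Lemma esp_straighten (k : nat) a b :
  esp k a.+1 * esp k b = esp k b * esp k.+1 a.+1 - esp k a * esp k.+1 b.+1 + esp k a * esp k b.+1.
Proof. by rewrite !espS; ring. Qed.

(** Insertion by level. If level [k] is already taken, [esp_straighten] moves one factor to level k
    + 1 in two of its terms and trades degrees (a + 1, b) for (a, b + 1) in the third; the inner
    induction on [a] ends at e_0 = 1. *)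
Lemma sem_span_insert M (k : nat) a l : word_ok M l -> (M <= k)%N -> sem_span M (a + word_deg l) (esp k a * esp_word l).
Proof.
elim: l M k a => [|[k1 b] l IH] M k a gl Mk.
  by rewrite -esp_word_cons -(word_deg_cons k); apply: sem_span_esp_word; rewrite /= Mk.
have /andP[Mk1 gl'] := gl.
case: (ltngtP k k1) => [kk|kk|ek].
- by rewrite -esp_word_cons -(word_deg_cons k); apply: sem_span_esp_word; rewrite /= Mk kk.
- rewrite esp_word_cons word_deg_cons mulrCA addnCA; apply: sem_span_cons => //.
  exact: IH.
rewrite esp_word_cons word_deg_cons; rewrite -ek in gl' *.
elim: a b {gl Mk1 ek} => [|a IHa] b.
  by rewrite esp_k0 mul1r add0n; apply: sem_span_cons => //; exact: sem_span_esp_word.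
rewrite mulrA esp_straighten !mulrDl mulNr -!mulrA; apply: sem_span_add; first apply: sem_span_sub.
- rewrite addnCA; apply: sem_span_cons => //; exact: IH.
- have -> : (a.+1 + (b + word_deg l) = a + (b.+1 + word_deg l))%N by lia.
  by apply: sem_span_cons => //; exact: IH.
have -> : (a.+1 + (b + word_deg l) = a + (b.+1 + word_deg l))%N by lia.
exact: IHa.
Qed.

Lemma sem_span_mul M d e f g : sem_span M d f -> sem_span M e g -> sem_span M (d + e) (f * g).
Proof.
move=> hf hg; elim: hf => [|c l f' gl <- _ IH]; first by rewrite mul0r; exact: sem_span0.
rewrite mulrDl -mulrA; apply: sem_span_add => //; apply: sem_span_CM => {IH}.
elim: l M gl hg => [|[k a] l IHl] M gl hg.
  by rewrite /esp_word /word_deg !big_nil mul1r.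
rewrite esp_word_cons word_deg_cons -mulrA -addnA; have /andP[Mk gl'] := gl.
apply: (@sem_span_bind M _ (word_deg l + e)) => [l' gl2 <-|]; first exact: sem_span_insert.
by apply: IHl => //; apply: word_ok_le gl'; lia.
Qed.

Lemma esp_alg_sem_span M d f : esp_alg M d f -> sem_span M d f.
Proof.
elim=> {d f} [d|c|k d Mk|d f g _ hf _ hg|d e f g _ hf _ hg].
- exact: sem_span0.
- have := @sem_span_CM M 0 c 1; rewrite mulr1; apply.
  by have := @sem_span_esp_word M [::] isT; rewrite /esp_word /word_deg !big_nil.
- have := @sem_span_esp_word M [:: (k, d)]; rewrite /esp_word /word_deg !big_seq1 /= andbT; exact.
- exact: sem_span_add.
exact: sem_span_mul.
Qed.

(** * From words to indices, and the expansion of shifted Schubert polynomials *)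

Definition level i : nat := if i is Posz k then k else 0%N.

(** This is [sem] at the index shifted by [t] ([sem_atE]), written over the support of the unshifted
    index so that different shifts compare factor by factor. *)
Definition sem_at t al : Pol := \prod_(i <- finsupp al) esp (level (i + t)) (al i).

Definition index_weight al : nat := \sum_(i <- finsupp al) al i.

Lemma shift_indexE t al i : shift_index t al i = al (i - t).
Proof.
rewrite /shift_index fsfun_fun; case: ifP => // /negbT h.
apply/esym/eqP; rewrite -memNfinsupp; apply: contra h => h.
by apply/imfsetP; exists (i - t) => //=; rewrite subrK.
Qed.

Lemma finsupp_shift t al : finsupp (shift_index t al) = [fset (j + t)%R | j in finsupp al]%fset.
Proof.
apply/fsetP => i; rewrite mem_finsupp shift_indexE -mem_finsupp.
apply/idP/imfsetP => [h|[j /= jm ->]]; last by rewrite addrK.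
by exists (i - t) => //=; rewrite subrK.
Qed.

Lemma sem_atE t al : zof (sem (shift_index t al)) = sem_at t al.
Proof.
rewrite /sem rmorph_prod finsupp_shift big_imfset /=; last by move=> x y _ _; apply: addIr.
by apply: eq_bigr => i _; rewrite shift_indexE addrK.
Qed.

(** Stated for a commutative monoid to serve both weights and products. The new entry [a] may be 0
    and then stays outside the support, whence the condition on [F i 0]. *)
Lemma big_with (R : Type) (idx : R) (op : Monoid.com_law idx) (F : int -> nat -> R) al j a :
  (forall i, F i 0%N = idx) -> al j = 0%N ->
  let al' : sem_index := [fsfun al with j |-> a] in
  \big[op/idx]_(i <- finsupp al') F i (al' i) =
  op (F j a) (\big[op/idx]_(i <- finsupp al) F i (al i)).
Proof.
move=> F0 aj al'.
have sub : (finsupp al' `<=` j |` finsupp al)%fset.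
  apply/fsubsetP => i; rewrite mem_finsupp fsfun_withE !inE.
  by case: (i =P j) => [//|_]; rewrite -mem_finsupp.
rewrite (big_fset_incl _ sub) /=; last by move=> i _; rewrite memNfinsupp => /eqP ->.
rewrite big_fsetU1 /=; last by rewrite memNfinsupp aj.
rewrite fsfun_with; congr (op _ _); apply: eq_big_seq => i ial.
rewrite fsfun_withE; case: (i =P j) => // e.
by move: ial; rewrite mem_finsupp e aj.
Qed.

Definition idx_of t l : sem_index :=
  foldr (fun (p : nat * nat) (al : sem_index) => [fsfun al with (p.1%:Z - t) |-> p.2]) [fsfun] l.

Lemma idx_ofP t M l : word_ok M l ->
  [/\ forall i, idx_of t l i != 0%N -> M%:Z <= i + t,
      index_weight (idx_of t l) = word_deg l & sem_at t (idx_of t l) = esp_word l].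
Proof.
elim: l M => [|[k a] l IH] M.
  by rewrite /index_weight /sem_at /esp_word /word_deg /= finsupp0 !big_nil; split=> // i; rewrite fsfun0E.
move=> /andP[Mk /IH[sl wl el]].
have z : idx_of t l (k%:Z - t) = 0%N.
  by apply/eqP/negPn/negP => /sl; lia.
split.
- move=> i; rewrite /= fsfun_withE; case: (i =P _) => [-> _|_ /sl]; lia.
- by rewrite /index_weight (@big_with _ 0%N addn (fun _ x => x)) // -/(index_weight _) wl word_deg_cons.
rewrite /sem_at (@big_with _ 1 *%R (fun i x => esp (level (i + t)) x)) //; last by move=> i; rewrite esp_k0.
by rewrite -/(sem_at _ _) el esp_word_cons subrK.
Qed.

Definition expand (F : sem_index -> Pol) (c : {fsfun sem_index -> rat with 0}) : Pol :=
  \sum_(al <- finsupp c) zC (c al) * F al.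

Lemma expandEw F c (D : {fset sem_index}) : (finsupp c `<=` D)%fset ->
  expand F c = \sum_(al <- D) zC (c al) * F al.
Proof.
move=> sD; rewrite /expand (big_fset_incl _ sD) // => al _.
by rewrite memNfinsupp => /eqP ->; rewrite rmorph0 mul0r.
Qed.

Lemma expand_with F (c : {fsfun sem_index -> rat with 0}) al x :
  expand F [fsfun c with al |-> x + c al] = zC x * F al + expand F c.
Proof.
set c' := [fsfun c with al |-> _].
have s1 : (finsupp c' `<=` al |` finsupp c)%fset.
  apply/fsubsetP => be; rewrite mem_finsupp fsfun_withE !inE.
  by case: (be =P al) => [//|_]; rewrite -mem_finsupp.
rewrite (expandEw F s1) (expandEw F (fsubsetUr [fset al]%fset (finsupp c))).
have hal : al \in (al |` finsupp c)%fset by rewrite !inE eqxx.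
rewrite (big_fsetD1 al hal) /= [in RHS](big_fsetD1 al hal) /= fsfun_with rmorphD mulrDl -addrA.
congr (_ + (_ + _)); apply: eq_big_seq => be; rewrite !inE => /andP[/negbTE hb _].
by rewrite fsfun_withE hb.
Qed.

Lemma sem_span_expand M d t f : sem_span M d f ->
  exists2 c : {fsfun sem_index -> rat with 0},
    forall al, al \in finsupp c -> (forall i, al i != 0%N -> M%:Z <= i + t) /\ index_weight al = d &
    f = expand (sem_at t) c.
Proof.
elim=> [|x l g gl dl _ [c hc ->]].
  exists [fsfun] => [al|]; first by rewrite finsupp0.
  by rewrite /expand finsupp0 big_nil.
have [sl wl el] := idx_ofP t gl.
(* The index of [l] may already be in the support of [c], so coefficients add up. *)
exists [fsfun c with idx_of t l |-> x + c (idx_of t l)]; last by rewrite expand_with el.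
move=> al; rewrite mem_finsupp fsfun_withE; case: (al =P _) => [-> _|_].
  by rewrite wl dl; split.
by rewrite -mem_finsupp => /hc.
Qed.

Lemma sem_at_homog t al : homog (index_weight al) (sem_at t al).
Proof.
rewrite /sem_at /index_weight; elim: (enum_fset _) => [|i r IH]; first by rewrite !big_nil; exact: hom1.
by rewrite !big_cons; apply: homM => //; exact: esp_homog.
Qed.

Lemma sem_at_sym t al M i : 1 <= i < M%:Z -> (forall j, al j != 0%N -> M%:Z <= j + t) ->
  zren (s_ i) (sem_at t al) = sem_at t al.
Proof.
move=> hi hal; rewrite /sem_at rmorph_prod; apply: eq_big_seq => j.
rewrite mem_finsupp => /hal hj; apply: esp_sym; first by case/andP: hi.
by rewrite /level; case: (j + t) hj => n hj; lia.
Qed.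

Lemma sem_at_kill1 t al : (forall j, al j != 0%N -> 0 <= j + t) ->
  kill1 (sem_at (t + 1) al) = zren incr (sem_at t al).
Proof.
move=> hal; rewrite /sem_at !rmorph_prod; apply: eq_big_seq => j.
rewrite mem_finsupp => /hal hj; rewrite -esp_kill1; congr (kill1 (esp _ _)).
rewrite addrA; case: (j + t) hj => [n _|n]; last by lia.
by have -> : Posz n + 1 = Posz n.+1 by lia.
Qed.

Lemma schub_expand w : in_SZ w ->
  exists (c : {fsfun sem_index -> rat with 0}) (T0 : nat), forall T : nat, (T0 <= T)%N ->
    in_Sinf (shift_perm T%:Z w) /\
    forall n : nat, upto n (shift_perm T%:Z w) ->
      schub n (shift_perm T%:Z w) = expand (sem_at T%:Z) c.
Proof.
move=> sw; have /in_SZP[p bp] := sw; have [bw fw] := bp.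
(* [w] moves nothing below -p, so a shift by at least p + K + 1 leaves everything up to [K] fixed;
   this gives the symmetry in x_1, ..., x_K. *)
pose K := (coxlen w).+1; pose T0 := (p + K.+1)%N.
pose u (r : nat) := shift_perm (T0 + r)%N%:Z w.
pose N (r : nat) := (T0 + r + p)%N.
have su r : in_SZ (u r) by exact: shift_in_SZ.
have fu r j : j <= K%:Z -> u r j = j by move=> hj; rewrite /u shift_permE fw; lia.
have iu r : in_Sinf (u r) by split=> // i i0; apply: fu; lia.
have up r : upto (N r) (u r).
  split; first exact: in_SZ_inj.
  by move=> j; rewrite /N => hj; rewrite /u shift_permE fw; lia.
have lu r : coxlen (u r) = coxlen w by exact: coxlen_shift.
have schom r : homog (coxlen w) (schub (N r) (u r)) by rewrite -(lu r); exact: schub_hom.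
have scsym r i : 1 <= i < K%:Z -> zren (s_ i) (schub (N r) (u r)) = schub (N r) (u r).
  move=> hi; rewrite schub_ren; [|lia|rewrite /N /T0; lia].
  have -> : desc (u r) i = false by rewrite /desc !fu; lia.
  by rewrite mulr0 addr0.
have scsupp r : pos_supp (schub (N r) (u r)).
  by move=> m /schub_supp h j; rewrite cmE_neq0 => /h /andP[].
(* The coefficients are determined at the smallest shift; the induction on [r] carries them to all
   larger ones. *)
have [c hc e0] := sem_span_expand T0%:Z (esp_alg_sem_span (esp_alg_of_sym (schom 0%N) (scsupp 0%N) (scsym 0%N))).
exists c, T0 => T hT; rewrite -(subnKC hT); move: (T - T0)%N => r {T hT}.
rewrite -/(u r); split=> // n un.
suff -> : schub n (u r) = schub (N r) (u r).
  suff main : schub (N r) (u r) - expand (sem_at (T0 + r)%N%:Z) c = 0.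
    by apply/eqP; rewrite -subr_eq0 main.
  elim: r {n un} => [|r IH]; first by rewrite addn0 -e0 subrr.
  set D := _ - _.
  have Dh : homog (coxlen w) D.
    apply: homB => //; rewrite /expand big_seq.
    elim/big_rec: _ => [|al f ial hf]; first exact: hom0.
    by apply: homD => //; apply: homCM; have [_ <-] := hc _ ial; exact: sem_at_homog.
  have Ds i : 1 <= i < K%:Z -> zren (s_ i) D = D.
    move=> hi; rewrite /D rmorphB scsym //; congr (_ - _).
    rewrite /expand rmorph_sum; apply: eq_big_seq => al ial.
    rewrite rmorphM zrenC (sem_at_sym hi) // => j /(proj1 (hc _ ial)); lia.
  have Dk : kill1 D = 0.
    rewrite -(rmorph0 (zren incr)) -IH !rmorphB; congr (_ - _).
      have -> : u r.+1 = shift_perm 1 (u r) by rewrite /u shift_permD; congr shift_perm; lia.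
      have -> : N r.+1 = (N r).+1 by rewrite /N addnS.
      exact: schub_shift.
    rewrite /expand !rmorph_sum; apply: eq_big_seq => al ial.
    rewrite !rmorphM zkillC zrenC; congr (_ * _).
    rewrite -sem_at_kill1; first by congr (kill1 (sem_at _ _)); lia.
    by move=> j /(proj1 (hc _ ial)); lia.
  apply: zcoefP => m; rewrite zcoef0; apply/eqP/negPn/negP => mD.
  have [m' _] := mdeg_full (all_vars Ds Dk mD); rewrite (Dh _ mD) /K; lia.
rewrite -(@schub_stable n (maxn n (N r))) //; last lia.
by rewrite (@schub_stable (N r) (maxn n (N r))) //; lia.
Qed.

End Straightening.

(** * Specialization and back stable limits *)

Section Truncation.
Implicit Types (al : sem_index) (F G : series).

Lemma eval1_zof (f : zpoly) : eval1 (zof f) = at_one f.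
Proof.
rewrite eval1E zofK /at_one mmapE; apply: eq_bigr => m _.
by rewrite /zcoef zofK mulr1.
Qed.

(** * Binomial polynomials and values of elementary symmetric polynomials *)

Definition binom_poly (y : rat) d : {poly rat} :=
  (d`!%:R)^-1 *: \prod_(j < d) ('X + (y - j%:R)%:P).

Lemma binom_polyE y d (x : rat) : (binom_poly y d).[x] = binom (x + y) d.
Proof.
rewrite /binom_poly /binom hornerZ horner_prod mulrC; congr (_ * _).
by apply: eq_bigr => j _; rewrite hornerD hornerX hornerC addrA.
Qed.

Definition B_poly al : {poly rat} := \prod_(i <- finsupp al) binom_poly i%:~R (al i).

Lemma B_polyE al (x : rat) : (B_poly al).[x] = B al x.
Proof. by rewrite /B_poly /B horner_prod; apply: eq_bigr => i _; rewrite binom_polyE. Qed.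

Lemma binom_nat (n d : nat) : (d <= n)%N -> binom n%:R d = 'C(n, d)%:R.
Proof.
move=> dn; rewrite /binom.
have -> : \prod_(j < d) (n%:R - j%:R) = (n ^_ d)%:R :> rat.
  elim: d dn => [|d IH] dn; first by rewrite big_ord0 ffactn0.
  by rewrite big_ord_recr /= IH ?ffactnSr ?natrM ?natrB //; lia.
by rewrite -bin_ffact natrM mulfK // pnatr_eq0 -lt0n fact_gt0.
Qed.

Lemma index_deg_ge al i : i \in finsupp al -> (al i)%:Z - i <= index_deg al.
Proof.
rewrite /index_deg; move: (_ - head 0 _) => x0.
have: {subset finsupp al <= enum_fset (finsupp al)} by [].
move=> /(_ i) h /h {h}; elim: (enum_fset _) => // j r IH.
rewrite big_cons inE => /orP[/eqP ->|/IH h]; rewrite le_max ?lexx //.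
by rewrite h orbT.
Qed.

(** The bound gives 0 <= alpha_i <= t + i on the support, and there the binomial counts the terms of
    the elementary symmetric polynomial. *)
Lemma B_at_large al t : index_deg al <= t -> B al t%:~R = eval1 (sem_at t al).
Proof.
move=> ht; rewrite /B /sem_at rmorph_prod; apply: eq_big_seq => i ial.
have hi := index_deg_ge ial; rewrite esp_eval1 -intrD [t + i]addrC.
case ei : (i + t) => [n|n]; last by lia.
by rewrite /level -pmulrn; apply: binom_nat; lia.
Qed.

(** * Reduced words and Macdonald's identity *)

Fixpoint reduced_word_seq (n L : nat) w : seq (seq int) :=
  if L is L'.+1 then
    [seq rcons a l.+1%:Z | l : nat <- [seq l : nat <- iota 0 n | desc w l.+1%:Z],
                           a : seq int <- reduced_word_seq n L' (w \o s_ l.+1%:Z)]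
  else [:: [::]].

Lemma reduced_word_seq_uniq n L w : uniq (reduced_word_seq n L w).
Proof.
elim: L w => //= L IH w; apply: allpairs_uniq_dep; first by rewrite filter_uniq ?iota_uniq.
  by move=> l _; exact: IH.
move=> [l a] [l' a'] _ _ /= /rcons_inj[-> e].
by have -> : l = l' by lia.
Qed.

(** The last letter of a reduced word is a descent, and the descents of such a [u] lie in 1, ..., n
    - 1, so enumerating by last letters is complete. *)
Lemma reduced_word_seqP n u a : in_Sinf u -> upto n u ->
  (a \in reduced_word_seq n (coxlen u) u) <-> reduced_words u a.
Proof.
move eL : (coxlen u) => L; elim: L u a eL => [|L IH] u a eL iu un.
  rewrite /reduced_words /= inE (coxlen0 (proj1 iu) eL); split=> [/eqP -> //|].
    by rewrite coxlen_id.
  by case; rewrite coxlen_id => /size0nil ->.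
rewrite /reduced_words /= eL; split.
  move=> /allpairsPdep[l [b [hl hb ->]]].
  move: hl; rewrite mem_filter mem_iota => /andP[dl hl].
  have ln : l.+1%:Z < n%:Z by rewrite ltNge; apply/negP => /(upto_ndesc un); rewrite dl.
  have el : coxlen (u \o s_ l.+1%:Z) = L by have := coxlen_desc (proj1 iu) dl; lia.
  have [] := proj1 (IH _ b el (@Sinf_comp _ l.+1%:Z isT iu) (upto_comp un ln)) hb.
  by rewrite el => sb eb; rewrite size_rcons sb word_perm_rcons eb comp_s_K.
case; elim/last_ind: a => // b k _; rewrite size_rcons word_perm_rcons => -[sb] eb.
have ebk : word_perm b = u \o s_ k by rewrite -eb comp_s_K.
have partial1_ : desc u k.
  by rewrite -(coxlen_lt _ (proj1 iu)) eL -ebk ltnS -sb; exact: coxlen_le_word.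
have k1 := Sinf_desc iu partial1_.
have kn : k < n%:Z by rewrite ltNge; apply/negP => /(upto_ndesc un); rewrite partial1_.
have el : coxlen (u \o s_ k) = L by have := coxlen_desc (proj1 iu) partial1_; lia.
have ek : `|(k - 1)%R|%N.+1%:Z = k by lia.
apply/allpairsPdep; exists `|(k - 1)%R|%N, b; rewrite ek mem_filter mem_iota ek partial1_.
split=> //=; first lia.
apply/(IH _ _ el (Sinf_comp k1 iu) (upto_comp un kn)).
by rewrite /reduced_words /= el.
Qed.

Lemma reduced_word_seq_sum n u : in_Sinf u -> upto n u ->
  \sum_(a <- reduced_word_seq n (coxlen u) u) \prod_(i <- a) i%:~R = (coxlen u)`!%:R * eval1 (schub n u).
Proof.
move eL : (coxlen u) => L; elim: L u eL => [|L IH] u eL iu un.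
  rewrite big_seq1 big_nil (coxlen0 (proj1 iu) eL).
  by rewrite schub_id rmorph1 mulr1.
rewrite /= big_allpairs_dep /= big_filter.
rewrite factS natrM mulrAC -eL (macdonald_step (proj1 iu) un) mulr_suml.
rewrite (_ : iota 0 n = index_iota 0 n) ?big_mkord; last by rewrite /index_iota subn0.
rewrite big_mkcond; apply: eq_bigr => l _; case: ifP => dl; last by rewrite mulr0 mul0r.
have ln : l.+1%:Z < n%:Z by rewrite ltNge; apply/negP => /(upto_ndesc un); rewrite dl.
have el : coxlen (u \o s_ l.+1%:Z) = L by have := coxlen_desc (proj1 iu) dl; lia.
have {}IH := IH _ el (@Sinf_comp _ l.+1%:Z isT iu) (upto_comp un ln).
rewrite -mulrA [eval1 _ * _]mulrC -IH mulr_sumr; apply: eq_bigr => a _.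
by rewrite -cats1 big_cat big_seq1 mulrC.
Qed.

Lemma shift_inj t w w' : shift_perm t w = shift_perm t w' -> w = w'.
Proof.
move=> e; rewrite -(shift_perm0 w) -(shift_perm0 w') -(addrN t).
by rewrite -!shift_permD e.
Qed.

Lemma T_horner (T n : nat) w : in_SZ w -> in_Sinf (shift_perm T%:Z w) ->
  upto n (shift_perm T%:Z w) -> (T_ w).[T%:R] = eval1 (schub n (shift_perm T%:Z w)).
Proof.
move=> sw iu un; set u := shift_perm T%:Z w in iu un *.
have lu : coxlen u = coxlen w by exact: coxlen_shift.
(* Subtracting [T] from the letters of the words of [u] gives the words of [w], so the factors T +
   a_i are the letters of a word of [u]. *)
pose r := [seq [seq i - T%:Z | i <- a] | a <- reduced_word_seq n (coxlen u) u].
have ur : uniq r.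
  rewrite map_inj_uniq ?reduced_word_seq_uniq //; apply: inj_map => x y; exact: addIr.
have er : reduced_words w = [set` r]%classic.
  apply/funext => a; apply/propext; split.
    move=> [sa ea]; suff : a \in r by [].
    apply/mapP; exists [seq i + T%:Z | i <- a].
      by apply/(reduced_word_seqP _ iu un); split; [rewrite size_map lu|rewrite -shift_word ea].
    by rewrite -map_comp map_id_in // => i _ /=; rewrite addrK.
  move=> ar; have : a \in r by [].
  case/mapP => b /(reduced_word_seqP _ iu un)[sb eb] ->; split; first by rewrite size_map sb.
  apply: (@shift_inj T%:Z); rewrite shift_word -map_comp map_id_in; first exact: eb.
  by move=> i _ /=; rewrite subrK.
rewrite /T_ er -(fsbig_seq _ _ ur) hornerZ horner_sum big_map.
rewrite (eq_bigr (fun a => \prod_(i <- a) i%:~R)); last first.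
  move=> a _; rewrite horner_prod big_map; apply: eq_bigr => i _.
  by rewrite hornerD hornerX hornerC rmorphB /= addrC subrK.
by rewrite reduced_word_seq_sum // lu mulKf // pnatr_eq0 -lt0n fact_gt0.
Qed.

(** * Truncation of power series *)

Definition shift_monom t m := rename_monom (fun j => j + t) (fun j => j - t) m.

Lemma shift_monomK1 t : cancel (fun j : int => j + t) (fun j => j - t).
Proof. by move=> j; rewrite addrK. Qed.
Lemma shift_monomK2 t : cancel (fun j : int => j - t) (fun j => j + t).
Proof. by move=> j; rewrite subrK. Qed.

Lemma shift_monomE t m i : shift_monom t m i = m (i - t).
Proof. by rewrite /shift_monom (rename_monomE _ _ (@shift_monomK2 t)). Qed.

Lemma shift_monom_mdeg t m : mdeg (shift_monom t m) = mdeg m.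
Proof. exact: (rename_monom_mdeg _ (@shift_monomK1 t) (@shift_monomK2 t)). Qed.

Lemma shift_monomK t m : shift_monom (- t) (shift_monom t m) = m.
Proof. by apply: cmonom_ext => i; rewrite !shift_monomE opprK addrK. Qed.

Lemma shift_monomNK t m : shift_monom t (shift_monom (- t) m) = m.
Proof. by apply: cmonom_ext => i; rewrite !shift_monomE opprK subrK. Qed.

Lemma shift_monomM t m1 m2 : shift_monom t (mmul m1 m2) = mmul (shift_monom t m1) (shift_monom t m2).
Proof. by apply: cmonom_ext => i; rewrite cmM !shift_monomE cmM. Qed.

(* [F] and [f] agree once [x_i = 0] for [i <= - T] in [F] and the indices are
   shifted by [T]. *)
Definition truncates (T : int) F f := forall m, (forall j, m j != 0%N -> 1 <= j + T) ->
  F m = zcoef (shift_monom T m) f.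

Lemma truncates1 T : truncates T series1 1.
Proof.
by move=> m _; rewrite /series1 zcoef1 -!mdeg_eq0 shift_monom_mdeg.
Qed.

(** A divisor of a monomial in the kept variables uses only kept variables, so both factors of each
    factorization can be read in the polynomials; this confines the sum to the finite supports of
    [f] and [g]. *)
Lemma truncates_mul T F G f g : truncates T F f -> truncates T G g -> truncates T (series_mul F G) (f * g).
Proof.
move=> hF hG m hm; rewrite /series_mul.
pose P : {pred monom * monom} := fun p => mmul p.1 p.2 == m.
have eP : [set p : monom * monom | mmul p.1 p.2 = m]%classic = [set` P]%classic.
  by apply/funext => p; apply/propext; split => [/eqP //|h]; exact/eqP.
rewrite eP.
pose r := [seq (shift_monom (- T) k1, shift_monom (- T) k2) | k1 : monom <- msupp (zto f), k2 : monom <- msupp (zto g)].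
have inj : injective (shift_monom (- T)) by apply: (can_inj (g := shift_monom T)) => m1; exact: shift_monomNK.
have ur : uniq r.
  apply: allpairs_uniq; rewrite ?fset_uniq //.
  by move=> [a b] [a' b'] _ _ /= [/inj -> /inj ->].
have fac p : P p -> F p.1 = zcoef (shift_monom T p.1) f /\ G p.2 = zcoef (shift_monom T p.2) g.
  move=> /eqP e; split; [apply: hF|apply: hG] => j hj; apply: hm; rewrite -e cmM; lia.
rewrite -(bigfs _ ur); last first.
  move=> p Pp pr; have [-> ->] := fac p Pp; apply/eqP; apply: contraNT pr.
  rewrite mulf_eq0 negb_or /zcoef !mcoeff_neq0 => /andP[h1 h2].
  apply/allpairsP; exists (shift_monom T p.1, shift_monom T p.2); split=> //=.
  by rewrite !shift_monomK; case: (p).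
rewrite big_mkcond big_allpairs_dep /zcoef rmorphM mcoeffMl.
apply: eq_bigr => k1 _; apply: eq_bigr => k2 _.
have -> : (mmul k1 k2 == shift_monom T m) = P (shift_monom (- T) k1, shift_monom (- T) k2).
  rewrite /P /= -shift_monomM; apply/eqP/eqP => [->|<-]; by rewrite ?shift_monomK ?shift_monomNK.
case: ifP => hP; last by [].
by have [/= -> ->] := fac _ hP; rewrite !shift_monomNK.
Qed.

(** The kept variables among x_j, j <= i, become x_1, ..., x_(i+T). If i + T <= 0 none is kept, in
    accordance with level 0. *)
Lemma truncates_esym T i d : truncates T (back_esym i d) (esp (level (i + T)) d).
Proof.
move=> m hm; rewrite /back_esym zcoef_esp shift_monom_mdeg; congr (nat_of_bool (_ && _))%:R.
apply/allP/squarefree_uptoP => h j.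
  rewrite shift_monomE cmE_neq0 => hj; have /andP[h1 /eqP ->] := h _ hj.
  have := hm (j - T); rewrite cmE_neq0 => /(_ hj) h2; split=> //.
  by rewrite /level; case e: (i + T) => [n|n]; lia.
rewrite -cmE_neq0 => hj; have h2 := hm _ hj.
have := h (j + T); rewrite shift_monomE addrK => /(_ hj)[h1 ->]; rewrite eqxx andbT.
by move: h1; rewrite /level; case e: (i + T) => [n|n]; lia.
Qed.

Lemma truncates_sem T al : truncates T (back_sem al) (sem_at T al).
Proof.
rewrite /back_sem /sem_at; elim/big_rec2: _ => [|i f F _ h]; first exact: truncates1.
by apply: truncates_mul => //; exact: truncates_esym.
Qed.

Lemma sem_at_pos_supp T al : pos_supp (sem_at T al).
Proof.
rewrite /sem_at; elim/big_rec: _ => [|i f _ hf].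
  by rewrite -(rmorph1 zC); exact: pos_suppC.
by apply: pos_suppM => //; exact: pos_supp_esp.
Qed.

Definition back_comb (c : {fsfun sem_index -> rat with 0}) : series :=
  fun m => \sum_(al <- finsupp c) c al * back_sem al m.

Lemma truncates_expand T c : truncates T (back_comb c) (expand (sem_at T) c).
Proof.
move=> m hm; rewrite /back_comb /expand zcoef_sum; apply: eq_bigr => al _.
by rewrite zcoefC (@truncates_sem T al m hm).
Qed.

Lemma expand_pos_supp T c : pos_supp (expand (sem_at T) c).
Proof.
rewrite /expand; elim/big_rec: _ => [|al f _ hf]; first by move=> m; rewrite zcoef0 eqxx.
by apply: pos_suppD => //; apply: pos_suppCM; exact: sem_at_pos_supp.
Qed.

Lemma mon_bound m : exists N : nat, forall (T : nat), (N <= T)%N ->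
  forall j, m j != 0%N -> 1 <= j + T%:Z.
Proof.
exists (\max_(j <- enum_fset (finsupp m)) `|j|).+1 => T hT j.
rewrite cmE_neq0 => jm.
have : (`|j| <= \max_(j <- enum_fset (finsupp m)) `|j|)%N.
  by rewrite (big_rem j) //= leq_maxl.
lia.
Qed.

(** Once [T] also exceeds the absolute values of the indices in [m], the coefficient of [m] at stage
    [T] is that of the fixed combination [c]; so the limit exists and equals it. *)
Lemma back_schubert_expand w c (T0 : nat) : in_SZ w ->
  (forall T : nat, (T0 <= T)%N -> in_Sinf (shift_perm T%:Z w) /\
    forall n : nat, upto n (shift_perm T%:Z w) ->
      schub n (shift_perm T%:Z w) = expand (sem_at T%:Z) c) ->
  back_schubert w = back_comb c.
Proof.
move=> sw hc; apply/funext => m; have [N hN] := mon_bound m.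
have key (T : nat) : (maxn T0 N <= T)%N ->
   (rename (fun j => j - T%:Z) (schubert (shift_perm T%:Z w)))@_m = back_comb c m.
  move=> hT; have [iu hs] := hc T ltac:(lia).
  have [n un] := upto_Sinf (proj1 iu).
  rewrite -[schubert _]zofK (schubert_schub iu un) -zto_ren -[LHS]/(zcoef m _).
  rewrite (zren_coef _ _ (@shift_monomK2 T%:Z) (@shift_monomK1 T%:Z)) (hs _ un).
  by rewrite (@truncates_expand T%:Z c m) //; apply: hN; lia.
rewrite /back_schubert; case: xgetP => [x _ [N' hx]|/(_ (back_comb c m))].
  pose T := maxn N' (maxn T0 N).
  by rewrite -(hx T) ?key //; [rewrite /T; lia|rewrite /T; lia|have [] := hc T ltac:(rewrite /T; lia)].
by case; exists (maxn T0 N) => n hn _; exact: key.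
Qed.

(** A priori [kappa w] may differ from the expansion of [schub_expand]. Both have the same sum as
    series, and truncation makes their polynomial sums agree at every large shift, where only
    monomials in positive variables occur. *)
Lemma kappaP w : in_SZ w -> exists T0 : nat, forall T : nat, (T0 <= T)%N ->
  in_Sinf (shift_perm T%:Z w) /\
  forall n : nat, upto n (shift_perm T%:Z w) ->
    schub n (shift_perm T%:Z w) = expand (sem_at T%:Z) (kappa w).
Proof.
move=> sw; have [c [T0 hc]] := schub_expand sw.
have e := back_schubert_expand sw hc.
have ek : back_schubert w = back_comb (kappa w).
  rewrite /kappa; case: xgetP => [c' _ hc'|/(_ c)]; first by apply/funext => m; exact: hc'.
  by case=> m; rewrite e.
exists T0 => T hT; have [iu hs] := hc T hT; split=> // n un.
rewrite (hs n un); apply: zcoefP => m.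
have [hm|hm] := pselect (forall j, m j != 0%N -> 1 <= j).
  have hm' j : shift_monom (- T%:Z) m j != 0%N -> 1 <= j + T%:Z by rewrite shift_monomE opprK => /hm.
  have h1 := @truncates_expand T%:Z c _ hm'; have h2 := @truncates_expand T%:Z (kappa w) _ hm'.
  by rewrite shift_monomNK in h1 h2; rewrite -h1 -h2 -ek e.
have z c' : zcoef m (expand (sem_at T%:Z) c') = 0.
  by apply/eqP/negPn/negP => /expand_pos_supp /hm.
by rewrite !z.
Qed.

Lemma poly_eq_large (p q : {poly rat}) (N : nat) :
  (forall n : nat, (N <= n)%N -> p.[n%:R] = q.[n%:R]) -> p = q.
Proof.
move=> h; apply/eqP; rewrite -subr_eq0; apply/negPn/negP => nz.
pose s : seq rat := [seq n%:R | n <- iota N (size (p - q))].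
have := @max_poly_roots _ (p - q) s nz.
rewrite /s size_map size_iota ltnn => h'; apply: notF; apply: h'.
  apply/allP => x /mapP[n]; rewrite mem_iota => /andP[Nn _] ->.
  by rewrite rootE hornerD hornerN h // subrr.
by rewrite map_inj_uniq ?iota_uniq // => a b /eqP; rewrite eqr_nat => /eqP.
Qed.

End Truncation.

Theorem proposition6p3 :
  exists Bpoly : sem_index -> {poly rat},
    [/\ forall (alpha : sem_index) (x : rat), (Bpoly alpha).[x] = B alpha x,
        forall (alpha : sem_index) (t : int), index_deg alpha <= t ->
          B alpha t%:~R = at_one (sem (shift_index t alpha))
      & forall w : int -> int, in_SZ w ->
          T_ w = \sum_(alpha <- finsupp (kappa w)) kappa w alpha *: Bpoly alpha].
Proof.
exists B_poly; split.
- exact: B_polyE.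
- by move=> al t ht; rewrite (B_at_large ht) -sem_atE eval1_zof.
move=> w sw; have [T0 hT0] := kappaP sw.
(* Beyond [T1] every index in the support of [kappa w] satisfies d(alpha) <= T, as [B_at_large]
   requires. *)
pose T1 := \max_(al <- enum_fset (finsupp (kappa w))) absz (index_deg al).
apply: (@poly_eq_large _ _ (maxn T0 T1)) => T hT.
have [iu hs] := hT0 T ltac:(lia).
have [n un] := upto_Sinf (proj1 iu).
rewrite (T_horner sw iu un) (hs _ un) horner_sum rmorph_sum.
apply: eq_big_seq => al ial; rewrite hornerZ B_polyE rmorphM eval1C; congr (_ * _).
rewrite -[X in B _ X]/((T%:Z)%:~R) B_at_large //.
have : (absz (index_deg al) <= T1)%N by rewrite /T1 (big_rem al) //= leq_maxl.
lia.
Qed.
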